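(* The Weighted $\mathcal{C}$-Coalition Formation problem can be solved in time $\mathrm{vc}^{\mathcal{O}(\mathrm{vc})}\, n^{\mathcal{O}(1)}$, where $n$ is the number of vertices and $\mathrm{vc}$ is the vertex cover number of the input graph.
   Context: Weighted $\mathcal{C}$-Coalition Formation: the input is an undirected graph $G=(V,E)$, an edge-weight function $w:E\to\mathbb{N}$ and a capacity $\mathcal{C}\in\mathbb{N}$. A $\mathcal{C}$-partition of $V$ is a partition $\mathcal{P}=\{C_1,\dots,C_p\}$ of $V$ with $|C_i|\le\mathcal{C}$ for all $i$; its value is $v(\mathcal{P})=\sum_{i=1}^p\sum_{e\in E(G[C_i])}w(e)$. The task is to compute a $\mathcal{C}$-partition of maximum value. The vertex cover number is the minimum size of a set $U\subseteq V$ meeting every edge. *)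

(* Defs.v *)
From mathcomp Require Import all_boot.

Set Implicit Arguments.
Unset Strict Implicit.
Unset Printing Implicit Defensive.

(* Graphs on the vertex set 'I_n are given by their set of edges, an edge     *)
(* being a 2-element set of vertices. A weight function is total on           *)
(* {set 'I_n}; only its values on edges are ever used.                        *)

Section CoalitionFormation.
Variable n : nat.
Implicit Types (E : {set {set 'I_n}}) (w : {set 'I_n} -> nat) (C : nat).
Implicit Types (U : {set 'I_n}) (P : {set {set 'I_n}}).

Definition simple_graph E : bool := [forall e in E, #|e| == 2].

Definition vertex_cover E U : bool := [forall e in E, U :&: e != set0].

(* The default argument [set: 'I_n] covers every simple graph. *)
Definition vc E : nat :=
  #|[arg min_(U < [set: 'I_n] | vertex_cover E U) #|U|]|.

Definition induced_edges E U : {set {set 'I_n}} := [set e in E | e \subset U].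

Definition C_partition C P : bool :=
  partition P [set: 'I_n] && [forall B in P, #|B| <= C].

Definition value E w P : nat :=
  \sum_(B in P) \sum_(e in induced_edges E B) w e.

Definition optimal_C_partition E w C P : Prop :=
  C_partition C P /\ forall Q, C_partition C Q -> value E w Q <= value E w P.

End CoalitionFormation.

(* Model of computation: a random access machine with unit cost, presented    *)
(* as a language of while programs. The memory consists of arrays of          *)
(* unbounded natural numbers; a program names its arrays by constants, hence  *)
(* uses finitely many of them, while indices are computed at run time. The    *)
(* arithmetic is addition and truncated subtraction only: without             *)
(* multiplication a computation of cost t lengthens numbers by O(t) bits, so  *)
(* that unit cost is polynomially related to Turing machine time.             *)

Definition state := nat -> nat -> nat.

Definition update (s : state) (a i x : nat) : state :=
  fun b j => if (b == a) && (j == i) then x else s b j.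

Inductive expr : Type :=
| Const of nat
| Get of nat & expr
| Add of expr & expr
| Sub of expr & expr.

Inductive cmd : Type :=
| Skip
| Assign of nat & expr & expr
| Seq of cmd & cmd
| If of expr & cmd & cmd
| While of expr & cmd.

Fixpoint eval (s : state) (e : expr) : nat :=
  match e with
  | Const k => k
  | Get a i => s a (eval s i)
  | Add e1 e2 => eval s e1 + eval s e2
  | Sub e1 e2 => eval s e1 - eval s e2
  end.

Fixpoint cost (e : expr) : nat :=
  match e with
  | Const _ => 1
  | Get _ i => (cost i).+1
  | Add e1 e2 | Sub e1 e2 => (cost e1 + cost e2).+1
  end.

(* exec c s t s': started in memory s, the program c halts after time t in    *)
(* memory s'. A test succeeds when its value is nonzero.                      *)
Inductive exec : cmd -> state -> nat -> state -> Prop :=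
| exec_Skip s : exec Skip s 1 s
| exec_Assign a i e s :
    exec (Assign a i e) s (cost i + cost e).+1 (update s a (eval s i) (eval s e))
| exec_Seq c1 c2 s1 s2 s3 t1 t2 :
    exec c1 s1 t1 s2 -> exec c2 s2 t2 s3 -> exec (Seq c1 c2) s1 (t1 + t2) s3
| exec_IfT e c1 c2 s s' t :
    eval s e != 0 -> exec c1 s t s' -> exec (If e c1 c2) s (cost e + t).+1 s'
| exec_IfF e c1 c2 s s' t :
    eval s e = 0 -> exec c2 s t s' -> exec (If e c1 c2) s (cost e + t).+1 s'
| exec_WhileF e c s :
    eval s e = 0 -> exec (While e c) s (cost e).+1 s
| exec_WhileT e c s1 s2 s3 t1 t2 :
    eval s1 e != 0 -> exec c s1 t1 s2 -> exec (While e c) s2 t2 s3 ->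
    exec (While e c) s1 (cost e + t1 + t2).+1 s3.

Section Encoding.
Variable n : nat.
Implicit Types (E : {set {set 'I_n}}) (w : {set 'I_n} -> nat) (C : nat).

(* Row-major layout: the entry (i, j) is at index i * n + j. *)
Definition matrix_array (f : 'I_n -> 'I_n -> nat) (k : nat) : nat :=
  match (insub (k %/ n) : option 'I_n), (insub (k %% n) : option 'I_n) with
  | Some i, Some j => f i j
  | _, _ => 0
  end.

(* Array 0 holds n and C, array 1 the adjacency matrix, array 2 the matrix of *)
(* edge weights; everything else is initially 0.                              *)
Definition input E w C : state := fun a k =>
  match a with
  | 0 => match k with 0 => n | 1 => C | _ => 0 end
  | 1 => matrix_array (fun i j => nat_of_bool ([set i; j] \in E)) k
  | 2 => matrix_array
           (fun i j => if [set i; j] \in E then w [set i; j] else 0) k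
  | _ => 0
  end.

(* The machine writes the label of a block for each vertex i in array 3 at    *)
(* index i; two vertices are in the same block iff their labels are equal.    *)
Definition output_partition (s : state) : {set {set 'I_n}} :=
  preim_partition (fun i : 'I_n => s 3 i) [set: 'I_n].

(* No C-partition exists when C = 0 < n; the machine has to tell this case    *)
(* apart in cell 0 of array 4.                                                *)
Definition correct_output E w C (s : state) : Prop :=
  if [exists P : {set {set 'I_n}}, C_partition C P]
  then s 4 0 = 1 /\ optimal_C_partition E w C (output_partition s)
  else s 4 0 = 0.

End Encoding.

(* Main.v *)
From mathcomp Require Import all_boot zify.
Require Import Defs.

Set Implicit Arguments.
Unset Strict Implicit.
Unset Printing Implicit Defensive.

(** The vertices matched by a greedy maximal matching form a vertex cover U with
    k = |U| <= 2 vc. Up to renaming, a partition is an assignment of labels 0..k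
    to the vertices: a label b < k names a block that meets U, while a vertex
    with label k is alone in its block, which loses nothing because a block that
    misses U contains no edge. The machine tries all (k+1)^k labellings of U.

    For a fixed labelling of U the other vertices contribute independently of
    each other, so it remains to solve an assignment problem with capacities.
    They are inserted one at a time. If the current assignment f is optimal and
    v is the next vertex, an optimal assignment after the insertion is obtained
    by a chain of moves: v enters a block, one vertex of this block moves to
    another one, and so on until a block with spare room is reached. No block
    occurs twice, since a cycle of moves does not improve f. Hence a map
    H : [0..k] -> [0..k] describes the chain up to the choice of the moving
    vertices, which can be made greedily block by block; all (k+1)^(k+1) maps H
    are tried. The total time is (k+1)^(2k+2) n^O(1). *)

(** * Exchange argument *)

(** The exchange arguments compare two assignments that agree on the cover: when they trade the
    labels of some vertices, both the sum of their loads and the sum of their values stay the same.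
    So if a competitor g and the optimum f trade moves, one gains exactly what the other loses, and
    no marginal gain of a single vertex has to be defined. Label k carries no capacity. It therefore
    serves for singletons, for vertices that still wait for their insertion, and as an end of a
    chain that always has room; accordingly H k is the block that v enters. On the machine side,
    loops whose bounds are fixed at entry make the meaning and the cost of a program structural
    recursions. Every loop bound is at most n+1 or equals (k+1)^(k+1), and only two loops are of the
    second kind, which gives the exponent 2k+2. *)

Lemma map_traject (T : Type) (h : T -> T) x r :
  map h (traject h x r) = traject h (h x) r.
Proof. by elim: r x => //= r IH x; rewrite IH. Qed.

Section Assignments.
Variables (n k C : nat) (W : nat -> nat -> nat) (inU : pred nat).
Implicit Types (f g : nat -> nat) (T : seq nat) (b x y : nat).

Definition load f b := \sum_(x < n) (f x == b).

Definition pair_weight f x y := if (f x == f y) && (f x < k) then W x y else 0.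

Definition aval f := \sum_(x < n) \sum_(y < n) pair_weight f x y.

Definition feasible f := forall b, b < k -> load f b <= C.

Definition upd f x b : nat -> nat := fun y => if y == x then b else f y.

Definition mix (T : seq nat) f g : nat -> nat :=
  fun x => if x \in T then g x else f x.

Definition swapped f1 f2 g1 g2 := forall x, x < n ->
  (f1 x = g1 x /\ f2 x = g2 x) \/ (f1 x = g2 x /\ f2 x = g1 x).

Lemma eq_load f g b : (forall x, x < n -> f x = g x) -> load f b = load g b.
Proof. by move=> e; apply: eq_bigr => x _; rewrite e. Qed.

Lemma eq_aval f g : (forall x, x < n -> f x = g x) -> aval f = aval g.
Proof.
move=> e; apply: eq_bigr => x _; apply: eq_bigr => y _.
by rewrite /pair_weight !e.
Qed.

Lemma eq_feasible f g :
  (forall x, x < n -> f x = g x) -> feasible f -> feasible g.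
Proof. by move=> e fe b bk; rewrite -(eq_load b e) fe. Qed.

Lemma load_swap f1 f2 g1 g2 b : swapped f1 f2 g1 g2 ->
  load f1 b + load f2 b = load g1 b + load g2 b.
Proof.
move=> sw; rewrite /load -!big_split; apply: eq_bigr => x _ /=.
by case: (sw x (ltn_ord x)) => -[-> ->] //; rewrite addnC.
Qed.

Hypothesis coverW : forall x y, x < n -> y < n -> ~~ inU x -> ~~ inU y -> W x y = 0.

(* Given the labels on the cover, the value is a sum over the remaining       *)
(* vertices, hence it is additive under swapping labels of such vertices.     *)
Lemma aval_swap f1 f2 g1 g2 : swapped f1 f2 g1 g2 ->
    (forall x, x < n -> inU x -> f1 x = f2 x) ->
  aval f1 + aval f2 = aval g1 + aval g2.
Proof.
move=> sw eqU; rewrite /aval -!big_split; apply: eq_bigr => x _ /=.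
rewrite -!big_split; apply: eq_bigr => y _ /=; rewrite /pair_weight.
have lx := ltn_ord x; have ly := ltn_ord y.
have eqU4 z : z < n -> inU z -> [/\ f2 z = f1 z, g1 z = f1 z & g2 z = f1 z].
  move=> zn zU; have e := eqU z zn zU.
  by case: (sw z zn) => -[e1 e2]; split; congruence.
case Ux: (inU x).
  have [-> -> ->] := eqU4 _ lx Ux.
  by case: (sw y ly) => -[-> ->] //; rewrite addnC.
case Uy: (inU y); last by rewrite coverW ?Ux ?Uy // !if_same.
have [-> -> ->] := eqU4 _ ly Uy.
by case: (sw x lx) => -[-> ->] //; rewrite addnC.
Qed.

Lemma swapped_mix T f g : swapped (mix T f g) (mix T g f) f g.
Proof. by move=> x _; rewrite /mix; case: (x \in T); [right | left]. Qed.

Lemma load_upd f x b c : x < n ->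
  load (upd f x b) c + (f x == c) = load f c + (b == c).
Proof.
move=> xn; rewrite /load (bigD1 (Ordinal xn)) //= [in RHS](bigD1 (Ordinal xn)) //=.
rewrite /upd eqxx; set A := (X in _ + X + _ = _); set B := (X in _ = _ + X + _).
suff -> : A = B by lia.
by apply: eq_bigr => y; rewrite -val_eqE /= => /negPf ->.
Qed.

(** Only the multisets of old and new labels of T matter. The identity is additive because
    subtraction on naturals truncates. *)
Lemma load_mix T f g b : uniq T -> (forall x, x \in T -> x < n) ->
  load (mix T f g) b + count_mem b (map f T) = load f b + count_mem b (map g T).
Proof.
elim: T => [|x T IH] //= /andP[xT uT] Tn.
have xn : x < n by apply: Tn; rewrite mem_head.
have IH' := IH uT (fun y yT => Tn y (mem_behead (s := x :: T) yT)).
have e : forall y, y < n -> mix (x :: T) f g y = upd (mix T f g) x (g x) y.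
  move=> y _; rewrite /mix /upd inE; by case: eqP => [->|].
have ex : mix T f g x = f x by rewrite /mix (negPf xT).
have := load_upd (mix T f g) (g x) b xn.
move: IH'; rewrite (eq_load b e) ex.
by move: (count _ (map f T)) (count _ (map g T)) => cf cg; lia.
Qed.

(** [base] prescribes the labels of the vertices that are not free to move: the cover, and the
    vertices still waiting with label k. *)
Definition admissible (base : nat -> nat) (movable : pred nat) f :=
  [/\ forall x, x < n -> f x <= k,
      forall x, x < n -> ~~ movable x -> f x = base x & feasible f].

Lemma eq_admissible base movable f g : (forall x, x < n -> f x = g x) ->
  admissible base movable f -> admissible base movable g.
Proof.
move=> e [h1 h2 h3]; split=> [x xn|x xn mx|]; last exact: eq_feasible h3.
  by rewrite -e // h1.
by rewrite -e // h2.
Qed.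

Definition optimal base movable f := admissible base movable f /\
  forall g, admissible base movable g -> aval g <= aval f.

Definition movable v x := ~~ inU x && (x < v).

(** All moves are read off the original labels [f x], hence happen simultaneously. At most one
    vertex leaves each block, and none leaves b when [m b] is not in b. *)
Definition shift f (H m : nat -> nat) i : nat -> nat :=
  fun x => if (f x < i) && (x == m (f x)) then H (f x) else f x.

Definition reassign f v H m := upd (shift f H m k) v (H k).

Definition move_from v f (m : nat -> nat) b :=
  [/\ m b < n, movable v (m b) & f (m b) = b].

(** * Insertion of one vertex along a chain of moves *)

Section Augmentation.
Variables (base : nat -> nat) (v : nat) (f : nat -> nat).
Hypotheses (vn : v < n) (vU : ~~ inU v) (basev : base v = k).
Hypothesis optf : optimal base (movable v) f.

Let fv : f v = k.
Proof. by case: optf => -[_ h _] _; rewrite h // /movable ltnn andbF. Qed.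

Definition distance g := \sum_(x < n) (f x != g x).

Section Path.
Variable g : nat -> nat.
Hypothesis admg : admissible base (movable v.+1) g.

Let full b := (b < k) && (C <= load f b).
Let mover b := find (fun y => (f y == b) && (g y != b)) (iota 0 n).
Let next b := if full b then g (mover b) else b.
Let entered b := exists2 x, x < n & f x != b /\ g x = b.

(** A block that is full under f and receives a vertex under g must also lose one, or its load under
    g would exceed C. *)
Let moverP b : full b -> entered b ->
  [/\ mover b < n, f (mover b) = b & g (mover b) != b].
Proof.
case/andP=> bk fb [x xn [fx gx]].
have hh : has (fun y => (f y == b) && (g y != b)) (iota 0 n).
  apply: contraT => /hasPn nh.
  suff: load f b < load g b by case: admg => _ _ /(_ b bk); lia.
  rewrite /load (bigD1 (Ordinal xn)) //= [ltnRHS](bigD1 (Ordinal xn)) //=.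
  rewrite (negPf fx) gx eqxx add0n add1n ltnS; apply: leq_sum => y _.
  have := nh y; rewrite mem_iota /= add0n ltn_ord => /(_ isT).
  by case: (f y == b) => //=; rewrite negbK => ->.
have := hh; rewrite has_find size_iota => mn.
have := nth_find 0 hh; rewrite -/(mover b) nth_iota // add0n => /andP[/eqP e1 e2].
by split.
Qed.

Let entered_next b : (full b -> entered b) -> full (next b) -> entered (next b).
Proof.
rewrite /next; case fb: (full b) => eb; last by rewrite fb.
move=> _; have [mn fm gm] := moverP fb (eb isT).
by exists (mover b) => //; split=> //; rewrite fm eq_sym.
Qed.

Let entered_iter i : full (iter i next (g v)) -> entered (iter i next (g v)).
Proof.
elim: i => [|i IH] /=; last exact: entered_next.
by case/andP=> gk _; exists v => //; split=> //; rewrite fv; lia.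
Qed.

Let path_entered r b : b \in traject next (g v) r -> full b -> entered b.
Proof. by case/trajectP=> i _ ->; apply: entered_iter. Qed.

Let mover_neq r b : b \in traject next (g v) r -> full b -> mover b != v.
Proof.
move=> bt fb; have [_ fm _] := moverP fb (path_entered bt fb).
by apply: contraTneq fb => e; move: fm; rewrite e fv => <-; rewrite /full ltnn.
Qed.

Let mover_changed x : x < n -> f x != g x -> movable v.+1 x.
Proof.
move=> xn; apply: contraR => mx.
case: admg => _ h _; rewrite h //; case: optf => -[_ h' _] _; rewrite h' //.
by apply: contra mx; rewrite /movable => /andP[-> /=]; lia.
Qed.

Let f_mover s r : {subset s <= traject next (g v) r} -> all full s ->
  map f (map mover s) = s.
Proof.
move=> st /allP fs; rewrite -map_comp -[RHS]map_id; apply/eq_in_map => b bs /=.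
by have [_ -> _] := moverP (fs _ bs) (path_entered (st _ bs) (fs _ bs)).
Qed.

Let g_mover s : all full s -> map g (map mover s) = map next s.
Proof.
move=> /allP fs; rewrite -map_comp; apply/eq_in_map => b bs /=.
by rewrite /next fs.
Qed.

Let uniq_mover s r : {subset s <= traject next (g v) r} -> all full s ->
  uniq s -> uniq (map mover s).
Proof. by move=> st fs us; apply: (@map_uniq _ _ f); rewrite (f_mover st). Qed.

Let mover_lt s r x : {subset s <= traject next (g v) r} -> all full s ->
  x \in map mover s -> x < n /\ f x != g x.
Proof.
move=> st /allP fs /mapP[b bs ->].
have [mn e ne] := moverP (fs _ bs) (path_entered (st _ bs) (fs _ bs)).
by rewrite e eq_sym.
Qed.

Let agreeU T x : x < n -> inU x -> mix T f g x = mix T g f x.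
Proof.
move=> xn xU; suff e : f x = g x by rewrite /mix e if_same.
by apply: contraTeq xU => /(mover_changed xn) /andP[].
Qed.

Let g_le x : x < n -> g x <= k. Proof. by case: admg => h _ _; apply: h. Qed.
Let f_le x : x < n -> f x <= k. Proof. by case: optf => -[h _ _] _; apply: h. Qed.

(** Two uses: if v keeps its waiting label k, the mixture competes with f before the insertion of v;
    with [w = v.+1] it competes with g after it. *)
Let adm_mix T h1 h2 w : (h1 = f /\ h2 = g) \/ (h1 = g /\ h2 = f) ->
    feasible (mix T h1 h2) -> (mix T h1 h2 v = k \/ w = v.+1) -> v <= w ->
  admissible base (movable w) (mix T h1 h2).
Proof.
move=> hh fe hv vw; split=> // x xn.
  rewrite /mix; case: hh => -[-> ->]; case: (x \in T); by rewrite ?f_le ?g_le.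
case: (eqVneq x v) => [-> {x xn}|xv] mx.
  by case: hv => [->//|e]; move: mx; rewrite e /movable vU ltnSn.
have mx' : ~~ movable v x.
  by apply: contra mx; rewrite /movable => /andP[-> /=]; lia.
have ef : f x = base x by case: optf => -[_ h _] _; apply: h.
have eg : g x = base x.
  case: admg => _ h _; apply: h => //; apply: contra mx'; rewrite /movable.
  by move=> /andP[-> /=]; move: xv; lia.
by rewrite /mix; case: hh => -[-> ->]; rewrite ef eg if_same.
Qed.

(* The iterates of next are the blocks visited by the chain of moves. The     *)
(* moves of g outside the chain, applied to f, do not improve f; hence the    *)
(* moves in the chain gain at least as much as g.                             *)
Let augment_free r : ~~ full (iter r next (g v)) ->
    (forall i, i < r -> full (iter i next (g v))) ->
  exists H m, [/\ forall b, b <= k -> H b <= k,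
      forall b, b < k -> H b != b -> move_from v f m b,
      feasible (reassign f v H m) & aval g <= aval (reassign f v H m)].
Proof.
set e := iter r next (g v) => ne fr.
set B := traject next (g v) r.
have fB : all full B by apply/allP => b /trajectP[i ir ->]; apply: fr.
have sB : {subset B <= traject next (g v) r} by [].
(* After a repetition the iterates would stay among the earlier full blocks, but the end [e] of the
   path is not full. *)
have uB : uniq B.
  rewrite /B; case: r @e ne fr @B fB sB => // r e ne fr B fB sB.
  rewrite looping_uniq; apply/negP => /loopingP /(_ r.+1) /trajectP[i ir ee].
  by move: ne; rewrite /e ee fr // ltnW.
have vB : v \notin map mover B.
  apply/mapP => -[b bB ee]; move: (mover_neq bB (allP fB _ bB)).
  by rewrite -ee eqxx.
set T := v :: map mover B.
have uT : uniq T by rewrite /= vB (uniq_mover sB).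
have Tn x : x \in T -> x < n.
  by rewrite inE => /predU1P[-> //|/(mover_lt sB fB)[]].
(* Along the chain g uses the labels [B] followed by [e], while f uses k followed by [B]. Below k,
   only the load of [e] changes, by one. *)
have cg : map g T = rcons B e by rewrite /= g_mover // -trajectSr /= map_traject.
have cf : map f T = k :: B by rewrite /= (f_mover sB) // fv.
have lm b : b < k -> load (mix T f g) b = load f b + (e == b).
  move=> bk; have := load_mix f g b uT Tn.
  rewrite cg cf -cats1 count_cat /=; case: (k =P b) => [|_]; lia.
have lm' b : b < k -> load (mix T g f) b + (e == b) = load g b.
  move=> bk; have := load_swap b (swapped_mix T f g); rewrite lm //; lia.
have ff b : b < k -> load f b <= C by case: optf => -[_ _ h] _; apply: h.
have fg b : b < k -> load g b <= C by case: admg => _ _; apply.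
have feT : feasible (mix T f g).
  move=> b bk; rewrite lm //; case: eqP => [eb|_]; last by rewrite addn0 ff.
  by move: ne; rewrite eb /full bk /=; lia.
have feT' : feasible (mix T g f).
  by move=> b bk; have := lm' b bk; have := fg b bk; lia.
have le1 : aval (mix T g f) <= aval f.
  case: optf => _; apply; apply: adm_mix => //; first by right.
  by left; rewrite /mix mem_head.
have le2 : aval g <= aval (mix T f g).
  have := aval_swap (swapped_mix T f g) (@agreeU T); lia.
(* Off the path [next] is not meaningful, since a full block that g does not enter may have no
   mover; there H is the identity. *)
pose H b := if b == k then g v else if b \in B then next b else b.
have eT x : x < n -> mix T f g x = reassign f v H mover x.
  move=> xn; rewrite /mix /reassign /upd /shift inE /H eqxx.
  case: eqP => [-> //|_] /=; case: ifP => [/mapP[b bB ->]|xT].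
    have [mn fm gm] := moverP (allP fB _ bB) (path_entered bB (allP fB _ bB)).
    rewrite fm; case/andP: (allP fB _ bB) => bk bf; rewrite bk eqxx /=.
    by rewrite ltn_eqF // bB /next /full bk bf.
  case: ltnP => //= xk; case: eqP => // ex; rewrite ltn_eqF //.
  by case: ifP => // fB'; move: xT; rewrite ex (map_f mover fB').
exists H, mover; split.
- move=> b bk; rewrite /H; case: eqP => _; first exact: g_le.
  case: ifP => // bB; rewrite /next (allP fB _ bB); apply: g_le.
  by have [] := moverP (allP fB _ bB) (path_entered bB (allP fB _ bB)).
- move=> b bk; rewrite /H (ltn_eqF bk); case: ifP; last by rewrite eqxx.
  move=> bB _; have fb := allP fB _ bB.
  have [mn fm gm] := moverP fb (path_entered bB fb).
  split=> //; have : movable v.+1 (mover b).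
    by apply: mover_changed => //; rewrite fm eq_sym.
  by rewrite /movable => /andP[-> /=]; move: (mover_neq bB fb); lia.
- exact: eq_feasible eT feT.
- by rewrite -(eq_aval eT).
Qed.

(* A cycle of moves between full blocks does not improve f, so it can be      *)
(* undone in g.                                                               *)
Let undo_cycle : (forall i, full (iter i next (g v))) ->
  exists g', [/\ admissible base (movable v.+1) g', aval g <= aval g' &
                 distance g' < distance g].
Proof.
move=> fa.
have lo : exists r, looping next (g v) r.
  exists k.+1; apply: contraT; rewrite -looping_uniq => /uniq_leq_size.
  move=> /(_ (iota 0 k)); rewrite size_traject size_iota => h.
  suff : k.+2 <= k by lia.
  apply: h => b /trajectP[i _ ->]; rewrite mem_iota /= add0n.
  by case/andP: (fa i).
case: (ex_minnP lo) => r lr mr {lo}.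
have ur : uniq (traject next (g v) r).
  case: r lr mr => // r _ mr; rewrite looping_uniq; apply/negP => /mr.
  by rewrite ltnn.
case/trajectP: lr => i ir ei.
set z := iter i next (g v); set Z := traject next z (r - i).
have itZ j : iter j next z = iter (j + i) next (g v) by rewrite iterD.
have sZ : {subset Z <= traject next (g v) r}.
  move=> b /trajectP[j jr ->]; rewrite itZ; apply/trajectP.
  by exists (j + i) => //; lia.
have fZ : all full Z by apply/allP => b /trajectP[j _ ->]; rewrite itZ.
have uZ : uniq Z.
  have : traject next (g v) r = traject next (g v) i ++ Z.
    by rewrite -{1}(subnKC (ltnW ir)) trajectD.
  by move=> e; move: ur; rewrite e cat_uniq => /and3P[].
(* [next] permutes the blocks of the cycle, so exchanging the movers changes no load. *)
have cZ b : count_mem b (map next Z) = count_mem b Z.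
  have e : z :: map next Z = rcons Z z.
    rewrite map_traject -[LHS]/(traject next z (r - i).+1) trajectSr.
    by rewrite itZ subnK ?(ltnW ir) // ei.
  have := congr1 (count_mem b) e; rewrite -cats1 count_cat /=; lia.
set T := map mover Z.
have uT : uniq T by apply: uniq_mover sZ fZ uZ.
have Tn x : x \in T -> x < n by case/(mover_lt sZ fZ).
have vT : v \notin T.
  apply/mapP => -[b bZ ee]; move: (mover_neq (sZ _ bZ) (allP fZ _ bZ)).
  by rewrite -ee eqxx.
have lm b : load (mix T f g) b = load f b.
  have := load_mix f g b uT Tn; rewrite /T (f_mover sZ) // g_mover // cZ; lia.
have lm' b : load (mix T g f) b = load g b.
  have := load_swap b (swapped_mix T f g); rewrite lm; lia.
have le1 : aval (mix T f g) <= aval f.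
  case: optf => -[_ _ ff]; apply; apply: adm_mix => //; first by left.
    by move=> b bk; rewrite lm ff.
  by left; rewrite /mix (negPf vT).
exists (mix T g f); split.
- apply: adm_mix => //; [by right | | by right].
  by move=> b bk; rewrite lm'; case: admg => _ _; apply.
- have := aval_swap (swapped_mix T f g) (@agreeU T); lia.
- have zT : mover z \in T.
    apply: map_f; rewrite /Z; have: 0 < r - i by lia.
    by case: (r - i) => // m _; rewrite trajectS mem_head.
  have [zn zne] := mover_lt sZ fZ zT.
  rewrite /distance (bigD1 (Ordinal zn)) //= [ltnRHS](bigD1 (Ordinal zn)) //=.
  rewrite {1}/mix zT eqxx zne add0n add1n ltnS; apply: leq_sum => x _.
  by rewrite /mix; case: (val x \in T) => //; rewrite eqxx.
Qed.

Lemma augment_or_undo :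
  (exists H m, [/\ forall b, b <= k -> H b <= k,
      forall b, b < k -> H b != b -> move_from v f m b,
      feasible (reassign f v H m) & aval g <= aval (reassign f v H m)]) \/
  (exists g', [/\ admissible base (movable v.+1) g', aval g <= aval g' &
                 distance g' < distance g]).
Proof.
(* Full blocks have labels below k, so k+1 of them in a row contain a repetition, after which all
   later iterates are full as well. *)
have [fa|] := boolP (all full (traject next (g v) k.+1)).
  right; apply: undo_cycle => i; apply: (allP fa); rewrite trajectSr mem_rcons.
  suff /loopingP lo : looping next (g v) k by rewrite inE lo orbT.
  apply: contraT; rewrite -looping_uniq => /uniq_leq_size.
  move=> /(_ (iota 0 k)); rewrite size_traject size_iota => h.
  suff : k.+1 <= k by lia.
  by apply: h => b /(allP fa) /andP[bk _]; rewrite mem_iota.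
case/allPn => b /trajectP[j _ ->] nf; left.
have ex : exists r, ~~ full (iter r next (g v)) by exists j.
case: (ex_minnP ex) => r nr mr; apply: (augment_free nr) => i ir.
by apply: contraT => /mr; lia.
Qed.

End Path.

(** Undoing a cycle brings g closer to f without lowering its value, so induction on the distance
    leads to a competitor whose chain ends. *)
Lemma augmentation g : admissible base (movable v.+1) g ->
  exists H m, [/\ forall b, b <= k -> H b <= k,
    forall b, b < k -> H b != b -> move_from v f m b,
    feasible (reassign f v H m) & aval g <= aval (reassign f v H m)].
Proof.
have [d] := ubnP (distance g); elim: d g => // d IH g dg ag.
case: (augment_or_undo ag) => [//|[g' [ag' le lt]]].
have [||H [m [h1 h2 h3 h4]]] := IH g' => //; first by lia.
by exists H, m; split=> //; lia.
Qed.

(** The default n is not a vertex: it makes [shift] move nothing out of b. *)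
Definition best_mover H (m : nat -> nat) b :=
  (move_from v f m b /\ forall x, x < n -> movable v x -> f x = b ->
     aval (upd f x (H b)) <= aval (upd f (m b) (H b))) \/
  ((forall x, x < n -> movable v x -> f x != b) /\ m b = n).

(** By additivity the gain of the move out of block i does not depend on the moves already made, so
    it can be maximised from f alone. The loads depend on H only, since exactly one vertex leaves
    each b with [H b != b]. *)
Lemma aval_shift_best H m0 m i :
    (forall b, b < k -> H b != b -> move_from v f m0 b) ->
    (forall b, b < k -> best_mover H m b) -> i <= k ->
  aval (shift f H m0 i) <= aval (shift f H m i) /\
  forall c, load (shift f H m0 i) c = load (shift f H m i) c.
Proof.
move=> h0 hm.
have sh0 m' : forall x, x < n -> shift f H m' 0 x = f x by [].
elim: i => [|i IH] ik.
  by rewrite !(eq_aval (sh0 _)); split=> // c; rewrite !(eq_load _ (sh0 _)).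
have [IH1 IH2] := IH (ltnW ik).
(* If H fixes i, moving a vertex of block i has no effect, whichever vertex is chosen. *)
have [Hi|Hi] := eqVneq (H i) i.
  have sh m' : forall x, x < n -> shift f H m' i.+1 x = shift f H m' i x.
    move=> x _; rewrite /shift ltnS leq_eqVlt; case: eqP => //= ->.
    by rewrite ltnn Hi if_same.
  by rewrite !(eq_aval (sh _)); split=> // c; rewrite !(eq_load _ (sh _)).
have mv0 := h0 i ik Hi.
have [mv bst] : move_from v f m i /\ forall x, x < n -> movable v x ->
    f x = i -> aval (upd f x (H i)) <= aval (upd f (m i) (H i)).
  case: (hm i ik) => // -[nm _]; case: mv0 => mn mm fm.
  by move: (nm _ mn mm); rewrite fm eqxx.
have sw m' : move_from v f m' i ->
    swapped (shift f H m' i.+1) f (shift f H m' i) (upd f (m' i) (H i)).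
  move=> [mn _ fm] x _; rewrite /upd /shift; have [->|xm] := eqVneq x (m' i).
    by right; rewrite fm ltnSn ltnn eqxx.
  left; split=> //; rewrite ltnS leq_eqVlt; case: eqP => //= e.
  by rewrite e ltnn /= (negPf xm).
have agU m' : (forall b, b < k -> H b != b -> move_from v f m' b \/ m' b = n) ->
    forall x, x < n -> inU x -> shift f H m' i.+1 x = f x.
  move=> hh x xn xU; rewrite /shift; case: ltnP => //= xi.
  case: eqP => // e; case: (eqVneq (H (f x)) (f x)) => // ne.
  case: (hh (f x) (leq_trans xi ik) ne) => [[_ + _]|e']; last by lia.
  by rewrite -e /movable xU.
have ag0 : forall x, x < n -> inU x -> shift f H m0 i.+1 x = f x.
  by apply: agU => b bk ne; left; apply: h0.
have ag : forall x, x < n -> inU x -> shift f H m i.+1 x = f x.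
  by apply: agU => b bk ne; case: (hm b bk) => -[]; [left | right].
have e0 := aval_swap (sw _ mv0) ag0; have e := aval_swap (sw _ mv) ag.
case: mv mv0 => mn mm fm [mn0 mm0 fm0].
split; first by have := bst _ mn0 mm0 fm0; lia.
move=> c; have l0 := load_swap c (sw _ (And3 mn0 mm0 fm0)).
have l := load_swap c (sw _ (And3 mn mm fm)).
have u0 := load_upd f (H i) c mn0; have u := load_upd f (H i) c mn.
rewrite fm0 in u0; rewrite fm in u; have := IH2 c; lia.
Qed.

Lemma reassign_best H m0 m :
    (forall b, b < k -> H b != b -> move_from v f m0 b) ->
    (forall b, b < k -> best_mover H m b) ->
    feasible (reassign f v H m0) ->
  feasible (reassign f v H m) /\
  aval (reassign f v H m0) <= aval (reassign f v H m).
Proof.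
move=> h0 hm fe; have [le eql] := aval_shift_best h0 hm (leqnn k).
have shv m' : shift f H m' k v = f v by rewrite /shift fv ltnn.
have sw m' : swapped (reassign f v H m') f (shift f H m' k) (upd f v (H k)).
  move=> x _; rewrite /reassign /upd; case: eqP => [->|_]; last by left.
  by right; rewrite shv.
have agU m' : (forall b, b < k -> H b != b -> move_from v f m' b \/ m' b = n) ->
    forall x, x < n -> inU x -> reassign f v H m' x = f x.
  move=> hh x xn xU; rewrite /reassign /upd; case: eqP => [e|_].
    by move: vU; rewrite -e xU.
  rewrite /shift; case: ltnP => //= xi.
  case: eqP => // e; case: (eqVneq (H (f x)) (f x)) => // ne.
  case: (hh (f x) xi ne) => [[_ + _]|e']; last by lia.
  by rewrite -e /movable xU.
have hm0 b : b < k -> H b != b -> move_from v f m0 b \/ m0 b = n.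
  by move=> bk ne; left; apply: h0.
have e0 : aval _ + _ = _ + _ := aval_swap (sw m0) (agU _ hm0).
have hm' b : b < k -> H b != b -> move_from v f m b \/ m b = n.
  by move=> bk _; case: (hm b bk) => -[]; [left | right].
have e : aval _ + _ = _ + _ := aval_swap (sw m) (agU _ hm').
split; last by lia.
move=> b bk; have := fe b bk.
have := load_swap b (sw m0); have := load_swap b (sw m); have := eql b; lia.
Qed.

Lemma reassign_admissible H m : (forall b, b <= k -> H b <= k) ->
    (forall b, b < k -> best_mover H m b) ->
    feasible (reassign f v H m) ->
  admissible base (movable v.+1) (reassign f v H m).
Proof.
move=> hH hm fe; case: optf => -[f1 f2 f3] _; split=> // x xn.
  rewrite /reassign /upd /shift; case: eqP => _; first exact: hH.
  by case: andP => [[xk _]|_]; [apply: hH; apply: ltnW | apply: f1].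
rewrite /reassign /upd => mx; case: eqP => [e|xv].
  by move: mx; rewrite e /movable vU ltnSn.
have nm : ~~ movable v x.
  by apply: contra mx; rewrite /movable => /andP[-> /=]; lia.
rewrite /shift; case: ltnP => /= xk; last exact: f2.
case: eqP => [e|_]; last exact: f2.
by case: (hm _ xk) => [[[_ + _]]|[_]]; [rewrite -e (negPf nm) | lia].
Qed.

End Augmentation.
End Assignments.

(** * Counting in mixed radix *)

Section Odometer.
Variable R : nat -> nat.

Definition place i := \prod_(j < i) R j.
Definition digits_value L (D : nat -> nat) := \sum_(i < L) D i * place i.
Definition digits L (D : nat -> nat) := forall i, i < L -> D i < R i.

Lemma placeS i : place i.+1 = place i * R i.
Proof. by rewrite /place big_ord_recr. Qed.

Lemma digits_valueS L D : digits_value L.+1 D = digits_value L D + D L * place L.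
Proof. by rewrite /digits_value big_ord_recr. Qed.

Lemma eq_digits_value L D D' : (forall i, i < L -> D i = D' i) ->
  digits_value L D = digits_value L D'.
Proof. by move=> e; apply: eq_bigr => i _; rewrite e. Qed.

Lemma digits_value_lt L D : digits L D -> digits_value L D < place L.
Proof.
elim: L => [|L IH] dD; first by rewrite /digits_value /place !big_ord0.
have := IH (fun i iL => dD i (ltnW iL)); have := dD L (ltnSn L).
by rewrite digits_valueS placeS; nia.
Qed.

Lemma digits_value_inj L D D' : digits L D -> digits L D' ->
  digits_value L D = digits_value L D' -> forall i, i < L -> D i = D' i.
Proof.
elim: L => // L IH dD dD'.
have dL : digits L D by move=> i iL; apply: dD; apply: ltnW.
have dL' : digits L D' by move=> i iL; apply: dD'; apply: ltnW.
rewrite !digits_valueS => e.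
have l := digits_value_lt dL; have l' := digits_value_lt dL'.
have eL : D L = D' L by nia.
move=> i; rewrite ltnS leq_eqVlt => /predU1P[-> //|]; apply: IH => //; nia.
Qed.

End Odometer.

(** * Programs with bounded loops *)

Inductive prog : Type :=
| PSkip
| PAssign of nat & expr & expr
| PSeq of prog & prog
| PIf of expr & prog & prog
| PFor of nat & expr & prog.

Definition Var a := Get a (Const 0).
Definition SetVar a e := PAssign a (Const 0) e.
Definition incr_cmd a := Assign a (Const 0) (Add (Var a) (Const 1)).

Fixpoint compile p : cmd :=
  match p with
  | PSkip => Skip
  | PAssign a i e => Assign a i e
  | PSeq p q => Seq (compile p) (compile q)
  | PIf e p q => If e (compile p) (compile q)
  | PFor a e p => Seq (Assign a (Const 0) (Const 0))
      (While (Sub e (Var a)) (Seq (compile p) (incr_cmd a)))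
  end.

Fixpoint den p (s : state) : state :=
  match p with
  | PSkip => s
  | PAssign a i e => update s a (eval s i) (eval s e)
  | PSeq p q => den q (den p s)
  | PIf e p q => if eval s e != 0 then den p s else den q s
  | PFor a e p =>
      iter (eval s e) (fun s => update (den p s) a 0 (den p s a 0 + 1))
           (update s a 0 0)
  end.

Fixpoint mods p : seq nat :=
  match p with
  | PSkip => [::]
  | PAssign a _ _ => [:: a]
  | PSeq p q | PIf _ p q => mods p ++ mods q
  | PFor a _ p => a :: mods p
  end.

Fixpoint reads e : seq nat :=
  match e with
  | Const _ => [::]
  | Get a i => a :: reads i
  | Add e1 e2 | Sub e1 e2 => reads e1 ++ reads e2
  end.

Fixpoint bounds p : seq expr :=
  match p with
  | PSkip | PAssign _ _ _ => [::]
  | PSeq p q | PIf _ p q => bounds p ++ bounds q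
  | PFor _ e p => e :: bounds p
  end.

Fixpoint counters_safe p : bool :=
  match p with
  | PSkip | PAssign _ _ _ => true
  | PSeq p q | PIf _ p q => counters_safe p && counters_safe q
  | PFor a _ p => (a \notin mods p) && counters_safe p
  end.

Definition bounds_safe (A : seq nat) p :=
  all (fun e => all (fun a => a \notin A) (reads e)) (bounds p).

Definition well_formed p := counters_safe p && bounds_safe (mods p) p.

(* Loop bounds are evaluated in the initial state; this is sound because the  *)
(* body of a well-formed loop leaves them unchanged.                          *)
Fixpoint time_bound p (s : state) : nat :=
  match p with
  | PSkip => 1
  | PAssign _ i e => (cost i + cost e).+1
  | PSeq p q => time_bound p s + time_bound q s
  | PIf e p q => (cost e + (time_bound p s + time_bound q s)).+1
  | PFor a e p => 3 + ((cost e + 3).+1 + eval s e * (cost e + 10 + time_bound p s))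
  end.

Lemma update_neq s a i x b : b != a -> update s a i x b = s b.
Proof. by move=> ne; rewrite /update (negPf ne). Qed.

Lemma update_eq s a i x : update s a i x a i = x.
Proof. by rewrite /update !eqxx. Qed.

Lemma update_same s a i x j : update s a i x a j = if j == i then x else s a j.
Proof. by rewrite /update eqxx. Qed.

Lemma den_frame p s a : a \notin mods p -> den p s a = s a.
Proof.
elim: p s => [|b i e|p IHp q IHq|e p IHp q IHq|b e p IHp] s //=.
- by rewrite inE => /update_neq ->.
- by rewrite mem_cat negb_or => /andP[ap aq]; rewrite IHq ?IHp.
- by rewrite mem_cat negb_or => /andP[ap aq]; case: ifP => _; auto.
- rewrite inE negb_or => /andP[ab ap].
  by elim: (eval s e) => [|m IH] /=; rewrite update_neq ?IHp.
Qed.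

Lemma eval_ext s s' e : (forall a, a \in reads e -> s a = s' a) -> eval s e = eval s' e.
Proof.
elim: e => //= [a i IHi|e1 IH1 e2 IH2|e1 IH1 e2 IH2] h.
- rewrite h ?mem_head // IHi // => b bi; apply: h; by rewrite inE bi orbT.
- by rewrite IH1 ?IH2 // => a ai; apply: h; rewrite mem_cat ai ?orbT.
- by rewrite IH1 ?IH2 // => a ai; apply: h; rewrite mem_cat ai ?orbT.
Qed.

Lemma time_bound_ext A p s s' : bounds_safe A p ->
  (forall a, a \notin A -> s a = s' a) -> time_bound p s = time_bound p s'.
Proof.
move=> + h; elim: p => [|b i e|p IHp q IHq|e p IHp q IHq|b e p IHp] //=.
- by rewrite /bounds_safe all_cat => /andP[/IHp-> /IHq->].
- by rewrite /bounds_safe all_cat => /andP[/IHp-> /IHq->].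
- rewrite /bounds_safe /= => /andP[/allP he /IHp ->].
  by rewrite (@eval_ext s s' e) // => a /he /h.
Qed.

Lemma bounds_safe_sub A B p : {subset B <= A} -> bounds_safe A p -> bounds_safe B p.
Proof.
move=> BA; apply: sub_all => e; apply: sub_all => a.
by apply: contra; apply: BA.
Qed.

Lemma exec_compile p s : well_formed p ->
  exists2 t, exec (compile p) s t (den p s) & t <= time_bound p s.
Proof.
case/andP; elim: p s => [|b i e|p IHp q IHq|e p IHp q IHq|b e p IHp] s.
- by exists 1 => //; constructor.
- by move=> _ _; exists (cost i + cost e).+1 => //; constructor.
- move=> /= /andP[cp cq]; rewrite /bounds_safe all_cat => /andP[bp bq].
  have subp : {subset mods p <= mods (PSeq p q)} by move=> a; rewrite mem_cat => ->.
  have subq : {subset mods q <= mods (PSeq p q)}.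
    by move=> a; rewrite mem_cat => ->; rewrite orbT.
  have [t1 e1 l1] := IHp s cp (bounds_safe_sub subp bp).
  have [t2 e2 l2] := IHq (den p s) cq (bounds_safe_sub subq bq).
  exists (t1 + t2); first exact: exec_Seq e1 e2.
  apply: leq_add => //; apply: leq_trans l2 _.
  rewrite (@time_bound_ext (mods (PSeq p q)) q _ s) // => a na.
  by rewrite den_frame //; apply: contra na; apply: subp.
- move=> /= /andP[cp cq]; rewrite /bounds_safe all_cat => /andP[bp bq].
  have subp : {subset mods p <= mods (PSeq p q)} by move=> a; rewrite mem_cat => ->.
  have subq : {subset mods q <= mods (PSeq p q)}.
    by move=> a; rewrite mem_cat => ->; rewrite orbT.
  have [t1 e1 l1] := IHp s cp (bounds_safe_sub subp bp).
  have [t2 e2 l2] := IHq s cq (bounds_safe_sub subq bq).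
  case: ifP => [ne|/negbFE/eqP e0].
    by exists (cost e + t1).+1; [apply: exec_IfT | lia].
  by exists (cost e + t2).+1; [apply: exec_IfF | lia].
- move=> /= /andP[bp cp]; rewrite /bounds_safe /= => /andP[be bb].
  have subp : {subset mods p <= b :: mods p} by move=> a ap; rewrite inE ap orbT.
  set step := fun s => update (den p s) b 0 (den p s b 0 + 1).
  set s0 := update s b 0 0; set m := eval s e.
  have fr i a : a \notin b :: mods p -> iter i step s0 a = s a.
    move=> na; have := na; rewrite inE negb_or => /andP[ab ap].
    elim: i => [|i IH]; first by rewrite /= /s0 update_neq.
    by rewrite iterS /step update_neq // den_frame.
  have cnt i : iter i step s0 b 0 = i.
    elim: i => [|i IH]; first by rewrite /= /s0 update_eq.
    by rewrite iterS /step update_eq den_frame // IH addn1.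
  have ev i : eval (iter i step s0) e = m.
    by apply: eval_ext => a /(allP be) na; apply: fr.
  have tb i : time_bound p (iter i step s0) = time_bound p s.
    by apply: (time_bound_ext bb) => a; apply: fr.
  (* Induction on the number j of remaining rounds. Besides [cost e], the 10 consists of 4 for the
     rest of the test and 6 for the increment. *)
  have run : forall j i, i + j = m -> exists2 t,
      exec (While (Sub e (Var b)) (Seq (compile p) (incr_cmd b)))
        (iter i step s0) t (iter m step s0) &
      t <= (cost e + 3).+1 + j * (cost e + 10 + time_bound p s).
    elim=> [|j IHj] i eij.
      exists (cost (Sub e (Var b))).+1; last by rewrite /=; lia.
      have -> : m = i by lia.
      by apply: exec_WhileF; rewrite /= ev cnt; lia.
    have [t2 e2 l2] := IHj i.+1 ltac:(lia).
    have [t1 e1 l1] := IHp (iter i step s0) cp (bounds_safe_sub subp bb).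
    eexists; first (apply: exec_WhileT; [|apply: exec_Seq; [exact: e1|]|exact: e2]).
    + by rewrite /= ev cnt; lia.
    + exact: exec_Assign.
    + by rewrite tb in l1; rewrite /=; lia.
  have [t et lt] := run m 0 erefl.
  exists (3 + t); last by rewrite leq_add2l.
  by apply: exec_Seq et; apply: exec_Assign.
Qed.

(** The invariant is asked of every state that agrees with the right one off the counter, so its
    uses need not mention the updates of the counter. *)
Lemma den_for (Inv : nat -> state -> Prop) a e p s : a \notin mods p ->
    (forall s', (forall b, b != a -> s' b = s b) -> Inv 0 s') ->
    (forall i s' s'', i < eval s e -> s' a 0 = i ->
       (forall b, b \notin a :: mods p -> s' b = s b) ->
       (forall b, b != a -> s'' b = den p s' b) -> Inv i s' -> Inv i.+1 s'') ->
  Inv (eval s e) (den (PFor a e p) s).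
Proof.
move=> ap h0 hS /=; set step := fun s => update _ a 0 _; set s0 := update s a 0 0.
have fr i b : b \notin a :: mods p -> iter i step s0 b = s b.
  move=> na; have := na; rewrite inE negb_or => /andP[ab bp].
  elim: i => [|i IH]; first by rewrite /= /s0 update_neq.
  by rewrite iterS /step update_neq // den_frame.
have cnt i : iter i step s0 a 0 = i.
  elim: i => [|i IH]; first by rewrite /= /s0 update_eq.
  by rewrite iterS /step update_eq den_frame // IH addn1.
have: eval s e <= eval s e by [].
elim: {1 3 4}(eval s e) => [|i IH] im /=.
  by apply: h0 => b ba; rewrite /s0 update_neq.
apply: (hS i (iter i step s0)) => //; last by apply: IH; lia.
  by move=> b; apply: fr.
by move=> b ba; rewrite /step update_neq.
Qed.

(** * Time bounds from the number of loops *)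

Fixpoint size_prog p : nat :=
  match p with
  | PSkip => 1
  | PAssign _ i e => (cost i + cost e).+1
  | PSeq p q => size_prog p + size_prog q
  | PIf e p q => (cost e + (size_prog p + size_prog q)).+1
  | PFor a e p => 3 + (cost e + 3).+1 + (cost e + 10 + size_prog p)
  end.

Fixpoint count_loops (P : pred expr) p : nat :=
  match p with
  | PSkip | PAssign _ _ _ => 0
  | PSeq p q | PIf _ p q => count_loops P p + count_loops P q
  | PFor a e p => P e + count_loops P p
  end.

(** All loops are counted rather than only nested ones. This costs a larger exponent of N, which is
    harmless; the few loops with bound M are nested anyway. *)
Lemma time_bound_le (P : pred expr) p s N M : 0 < N -> 0 < M ->
    all (fun e => eval s e <= if P e then M else N) (bounds p) ->
  time_bound p s <=
    size_prog p * (N ^ count_loops (predC P) p * M ^ count_loops P p).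
Proof.
move=> N0 M0.
have pos a b : 0 < N ^ a * M ^ b by rewrite muln_gt0 !expn_gt0 N0 M0.
have mono a a' b b' : N ^ a * M ^ b <= N ^ (a + a') * M ^ (b + b').
  by apply: leq_mul; apply: leq_pexp2l => //; apply: leq_addr.
have mono' a a' b b' : N ^ a' * M ^ b' <= N ^ (a + a') * M ^ (b + b').
  by rewrite addnC [b + _]addnC mono.
elim: p => [|b i e|p IHp q IHq|e p IHp q IHq|b e p IHp] /=.
- by rewrite muln1.
- by rewrite muln1.
- rewrite all_cat => /andP[/IHp lp /IHq lq].
  rewrite mulnDl; apply: leq_add.
    by apply: leq_trans lp _; rewrite leq_mul2l mono orbT.
  by apply: leq_trans lq _; rewrite leq_mul2l mono' orbT.
- rewrite all_cat => /andP[/IHp lp /IHq lq].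
  set c1 := count_loops (predC P) p in lp *.
  set c2 := count_loops (predC P) q in lq *.
  set d1 := count_loops P p in lp *; set d2 := count_loops P q in lq *.
  have lp' := leq_trans lp (leq_mul (leqnn (size_prog p)) (mono _ c2 _ d2)).
  have lq' := leq_trans lq (leq_mul (leqnn (size_prog q)) (mono' c1 _ d1 _)).
  move: lp' lq' (pos (c1 + c2) (d1 + d2)).
  by move: (N ^ _ * M ^ _) => X; nia.
- move=> /andP[le /IHp lp].
  have -> : N ^ (predC P e + count_loops (predC P) p) * M ^ (P e + count_loops P p) =
      (if P e then M else N) * (N ^ count_loops (predC P) p * M ^ count_loops P p).
    by rewrite /=; case: (P e); rewrite /= ?add0n ?add1n expnS; lia.
  have Z0 : 0 < (if P e then M else N) by case: ifP.
  move: lp (pos (count_loops (predC P) p) (count_loops P p)) le Z0.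
  move: (N ^ _ * M ^ _) (if _ then _ else _) => X Z lp X0 le Z0.
  move: (cost e) (size_prog p) lp => c sp lp.
  have h1 : c + 10 + time_bound p s <= (c + 10 + sp) * X by nia.
  have h2 := leq_mul le h1.
  have h3 : 0 < Z * X by rewrite muln_gt0 Z0.
  rewrite mulnDl addnA; apply: leq_add; first by rewrite leq_pmulr.
  by rewrite mulnCA.
Qed.

(** * Enumeration of the labellings *)

Arguments den : simpl never.

Definition eqE e1 e2 := Sub (Const 1) (Add (Sub e1 e2) (Sub e2 e1)).
Definition When e p := PIf e p PSkip.
Notation "p ;; q" := (PSeq p q) (at level 90, right associativity).

Lemma den_seq p q s : den (p ;; q) s = den q (den p s). Proof. by []. Qed.

Lemma den_if e p q s :
  den (PIf e p q) s = if eval s e != 0 then den p s else den q s.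
Proof. by []. Qed.

Lemma den_when e p s : den (When e p) s = if eval s e != 0 then den p s else s.
Proof. by []. Qed.

Lemma den_assign a i e s : den (PAssign a i e) s = update s a (eval s i) (eval s e).
Proof. by []. Qed.

Lemma den_set a e s : den (SetVar a e) s = update s a 0 (eval s e).
Proof. by []. Qed.

Lemma eval_eqE s e1 e2 : (eval s (eqE e1 e2) != 0) = (eval s e1 == eval s e2).
Proof. by rewrite /=; apply/idP/eqP; lia. Qed.

Lemma eval_ltE s e1 e2 : (eval s (Sub e2 e1) != 0) = (eval s e1 < eval s e2).
Proof. by rewrite /=; lia. Qed.

(* Memory layout. 5: offsets of the rows of the input matrices; 6: indicator  *)
(* of the cover U; 7: k = |U|; 8: (k+1)^(k+1); 9: scratch; 10, 11: radices of *)
(* the odometers 12 (labelling of U) and 13 (map H); 14: current assignment;  *)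
(* 15, 16: best assignment of the insertion step and its value; 17: candidate *)
(* for H; 18: argument of VAL and FEAS, with results in 19 and 22; 20, 21:    *)
(* best value plus one and best moving vertex; 23: counter; 24, 25: best      *)
(* assignment overall and its value plus one; 26: carry; 30 and above: loop   *)
(* counters, in particular 36 a block and 38 the inserted vertex.             *)
Definition nE := Get 0 (Const 0).
Definition n1E := Add nE (Const 1).
Definition cE := Get 0 (Const 1).
Definition kE := Var 7.
Definition mE := Var 8.

Definition COPY dst src := PFor 30 nE (PAssign dst (Var 30) (Get src (Var 30))).

Definition ZERO D e := PFor 42 e (PAssign D (Var 42) (Const 0)).

Definition VAL :=
  SetVar 19 (Const 0) ;;
  PFor 31 nE (PFor 32 nE
    (When (eqE (Get 18 (Var 31)) (Get 18 (Var 32)))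
    (When (Sub kE (Get 18 (Var 31)))
      (SetVar 19 (Add (Var 19) (Get 2 (Add (Get 5 (Var 31)) (Var 32)))))))).

(** Here and below, a loop over the labels runs to n or n+1 with a test against k, so that few kinds
    of loop bounds occur. *)
Definition FEAS :=
  SetVar 22 (Const 1) ;;
  PFor 33 nE (When (Sub kE (Var 33))
    (SetVar 23 (Const 0) ;;
     PFor 34 nE (When (eqE (Get 18 (Var 34)) (Var 33))
       (SetVar 23 (Add (Var 23) (Const 1)))) ;;
     When (Sub (Var 23) cE) (SetVar 22 (Const 0)))).

Definition INCR D R e :=
  SetVar 26 (Const 1) ;;
  PFor 41 e (When (Var 26)
    (PIf (eqE (Add (Get D (Var 41)) (Const 1)) (Get R (Var 41)))
      (PAssign D (Var 41) (Const 0))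
      (PAssign D (Var 41) (Add (Get D (Var 41)) (Const 1)) ;;
       SetVar 26 (Const 0)))).

Lemma copyP dst src s : dst != src -> dst != 30 -> src != 30 ->
  forall x, x < s 0 0 -> den (COPY dst src) s dst x = s src x.
Proof.
move=> ds d3 s3; rewrite -[s 0 0]/(eval s nE).
apply: (@den_for (fun i s' => forall x, x < i -> s' dst x = s src x)) => //.
  by rewrite /= inE eq_sym.
move=> i s' s'' _ ci fr e IH x xi; rewrite e // den_assign update_same /= ci.
case: eqP => [->|ne]; last by rewrite IH //; lia.
by rewrite fr // !inE negb_or s3 eq_sym.
Qed.

Lemma zeroP D e s : D != 42 -> forall x, x < eval s e -> den (ZERO D e) s D x = 0.
Proof.
move=> d3.
apply: (@den_for (fun i s' => forall x, x < i -> s' D x = 0)) => //.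
  by rewrite /= inE eq_sym.
move=> i s' s'' _ ci fr e' IH x xi; rewrite e' // den_assign update_same /= ci.
by case: eqP => // ne; rewrite IH //; lia.
Qed.

(** The counter wraps to zero after its last value. Hence the digits stay legal in all cases, but
    the value is claimed only short of an overflow. *)
Lemma incrP D R e s (rad : nat -> nat) :
    [/\ D != R, D != 26, D != 41, R != 26 & R != 41] -> 26 \notin reads e ->
    digits rad (eval s e) (s D) ->
    (forall i, i < eval s e -> s R i = rad i) ->
  digits rad (eval s e) (den (INCR D R e) s D) /\
  ((digits_value rad (eval s e) (s D)).+1 < place rad (eval s e) ->
   digits_value rad (eval s e) (den (INCR D R e) s D) =
   (digits_value rad (eval s e) (s D)).+1).
Proof.
move=> [DR D26 D41 R26 R41] e26 dD hR.
rewrite /INCR den_seq; set s1 := den _ s.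
have ee : eval s1 e = eval s e.
  apply: eval_ext => a ae; rewrite /s1 den_frame // inE.
  by apply: contraNneq e26 => <-.
have s1D : s1 D = s D by rewrite /s1 den_frame //= inE.
move: dD hR; rewrite -ee; move eL: (eval s1 e) => L dD hR.
(* The carry in array 26 stands for one unit at the current place. *)
pose Inv i (t : state) := [/\ forall j, i <= j -> t D j = s D j,
    forall j, j < i -> t D j < rad j, t 26 0 <= 1 &
    digits_value rad i (t D) + t 26 0 * place rad i = digits_value rad i (s D) + 1].
set p := PFor _ _ _.
have [h1 h2 h3 h4] : Inv L (den p s1); last first.
  split=> [//|lt]; case: (den _ _ 26 0) h3 h4 => [|[|//]] _ h4; nia.
rewrite -eL; apply: den_for.
- by rewrite /= !inE !negb_or eq_sym D41.
- move=> t et; split.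
  + by move=> j _; rewrite et // s1D.
  + by [].
  + by rewrite et // /s1 den_set update_eq.
  + by rewrite (et 26) // /s1 den_set update_eq /digits_value /place !big_ord0.
move=> i t t'' iL ci fr et [IH1 IH2 IH3 IH4].
rewrite eL in iL.
have tR : t R i = rad i.
  by rewrite fr /s1 ?den_frame ?hR //= !inE ?negb_or ?R41 ?R26 ?[R == D]eq_sym ?DR.
rewrite /Inv !placeS !digits_valueS.
have eqi D1 : (forall j, j < i -> D1 j = t D j) ->
    digits_value rad i D1 = digits_value rad i (t D).
  exact: eq_digits_value.
have Di := IH1 i (leqnn i); have Dl := dD i iL.
have e26' := congr1 (@^~ 0) (et 26 isT); have eD := et D D41; move: e26' eD.
rewrite den_when den_if eval_eqE /= ci tR Di.
case: eqP => [c0|/eqP c1] /=.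
  move=> e26' eD; rewrite e26' eD; split=> //.
  - by move=> j ij; apply: IH1; lia.
  - move=> j; rewrite ltnS leq_eqVlt => /predU1P[->|]; last exact: IH2.
    by rewrite Di.
  - by rewrite c0 in IH4 *; rewrite Di; lia.
have {}c1 : t 26 0 = 1 by lia.
case: eqP => [cy|ncy].
  rewrite den_assign update_neq /= ?[26 == _]eq_sym // ci => e26' eD.
  have eDj j : t'' D j = if j == i then 0 else t D j by rewrite eD update_same.
  rewrite e26' (eqi (t'' D)) => [|j ji]; last by rewrite eDj ltn_eqF.
  split=> //.
  - by move=> j ij; rewrite eDj gtn_eqF // IH1 // ltnW.
  - move=> j; rewrite eDj ltnS leq_eqVlt; case: eqP => [->|_] /=; last exact: IH2.
    by lia.
  - by rewrite eDj eqxx; rewrite c1 in IH4 *; nia.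
rewrite den_seq den_set update_eq update_neq // den_assign /= ci => e26' eD.
have eDj j : t'' D j = if j == i then s D i + 1 else t D j.
  by rewrite eD update_same Di.
rewrite e26' (eqi (t'' D)) => [|j ji]; last by rewrite eDj ltn_eqF.
split=> //.
- by move=> j ij; rewrite eDj gtn_eqF // IH1 // ltnW.
- move=> j; rewrite eDj ltnS leq_eqVlt; case: eqP => [->|_] /=; last exact: IH2.
  by lia.
- by rewrite eDj eqxx; rewrite c1 in IH4; nia.
Qed.

(** * Programs for the insertion step and for the search over labellings *)

Definition MOVER :=
  SetVar 20 (Const 0) ;;
  PFor 35 nE
    (When (Sub (Var 38) (Var 35)) (When (Sub (Const 1) (Get 6 (Var 35)))
    (When (eqE (Get 14 (Var 35)) (Var 36))
      (COPY 18 14 ;; PAssign 18 (Var 35) (Get 13 (Var 36)) ;; VAL ;;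
       When (Sub (Add (Var 19) (Const 1)) (Var 20))
         (SetVar 20 (Add (Var 19) (Const 1)) ;; SetVar 21 (Var 35)))))).

(** Each move is evaluated against array 14, not against the partly changed array 17; by additivity
    this selects equally good movers. *)
Definition CAND :=
  COPY 17 14 ;;
  PFor 36 nE (When (Sub kE (Var 36))
    (MOVER ;; When (Var 20) (PAssign 17 (Var 21) (Get 13 (Var 36))))) ;;
  PAssign 17 (Var 38) (Get 13 kE).

Definition TRY :=
  CAND ;; COPY 18 17 ;; FEAS ;; VAL ;;
  When (Var 22) (When (Sub (Var 19) (Var 16))
    (SetVar 16 (Var 19) ;; COPY 15 17)).

Definition STAGE :=
  COPY 15 14 ;; COPY 18 14 ;; VAL ;; SetVar 16 (Var 19) ;; ZERO 13 n1E ;;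
  PFor 37 mE (TRY ;; INCR 13 11 n1E) ;;
  COPY 14 15.

Definition INIT := PFor 40 nE
  (PIf (Get 6 (Var 40)) (PAssign 14 (Var 40) (Get 12 (Var 40)))
                        (PAssign 14 (Var 40) kE)).

Definition SOLVE :=
  INIT ;; COPY 18 14 ;; FEAS ;;
  When (Var 22)
    (PFor 38 nE (When (Sub (Const 1) (Get 6 (Var 38))) STAGE) ;;
     COPY 18 14 ;; VAL ;;
     When (Sub (Add (Var 19) (Const 1)) (Var 25))
       (SetVar 25 (Add (Var 19) (Const 1)) ;; COPY 24 14)).

Definition MAIN := PFor 39 mE (SOLVE ;; INCR 12 10 nE).

(** What the search reads but never writes: the input data it uses and the results of the
    preprocessing. That a program respects this is decided by computing [mods]. *)
Definition envs := [:: 0; 2; 5; 6; 7; 8; 10; 11].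

(** * Correctness of the search *)

Section Machine.
Variables (n k C : nat) (W : nat -> nat -> nat) (inU : pred nat) (e0 : state).
Hypothesis e0n : e0 0 0 = n.
Hypothesis e0C : e0 0 1 = C.
Hypothesis e0k : e0 7 0 = k.
Hypothesis e0W : forall x y, x < n -> y < n -> e0 2 (e0 5 x + y) = W x y.
Hypothesis e0U : forall x, x < n -> e0 6 x = inU x.
Hypothesis kn : k <= n.

Definition env (s : state) := forall b, b \in envs -> s b = e0 b.

Lemma env_frame (A : seq nat) s s' : (forall b, b \notin A -> s' b = s b) ->
  all [pred b | b \notin A] envs -> env s -> env s'.
Proof. by move=> fr /allP h es b bE; rewrite fr ?es //; apply: h. Qed.

Lemma env_den p s : all [pred b | b \notin mods p] envs -> env s -> env (den p s).
Proof. by apply: env_frame => b; apply: den_frame. Qed.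

Lemma eval_nE s : env s -> eval s nE = n.
Proof. by move=> es /=; rewrite es. Qed.

Lemma eval_kE s : env s -> eval s kE = k.
Proof. by move=> es /=; rewrite es. Qed.

Lemma val_progP s : env s -> den VAL s 19 0 = aval n k W (s 18).
Proof.
move=> es; rewrite /VAL den_seq; set s1 := den _ s.
have es1 : env s1 by apply: env_den es.
set pw := fun x y => pair_weight k W (s 18) x y.
have -> : aval n k W (s 18) = \sum_(x < eval s1 nE) \sum_(y < n) pw x y.
  by rewrite eval_nE.
apply: (@den_for (fun i s' => s' 19 0 = \sum_(x < i) \sum_(y < n) pw x y)) => //.
  by move=> s' e; rewrite e // big_ord0.
move=> i s' s'' ; rewrite eval_nE // => ni ci fr e IH.
have es' : env s' by apply: env_frame fr _ es1.
rewrite e // big_ord_recr /= -IH.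
have -> : \sum_(y < n) pw i y = \sum_(y < eval s' nE) pw i y by rewrite eval_nE.
apply: (@den_for (fun j t => t 19 0 = s' 19 0 + \sum_(y < j) pw i y)) => //.
  by move=> t et; rewrite et // big_ord0 addn0.
move=> j t t''; rewrite eval_nE // => nj cj frt et IHt.
have est : env t by apply: env_frame frt _ es'.
rewrite et // big_ord_recr /= addnA -IHt !den_when eval_eqE eval_ltE eval_kE //.
have t18 : t 18 = s 18 by rewrite frt // fr // /s1 den_frame.
have t31 : t 31 0 = i by rewrite frt.
rewrite /= t18 cj t31 /pw /pair_weight.
case: eqP => _ /=; last by rewrite addn0.
case: ltnP => _ /=; last by rewrite addn0.
by rewrite den_set update_eq /= cj t31 (est 2) // (est 5) // e0W.
Qed.

Lemma feasP s : env s -> den FEAS s 22 0 != 0 <-> feasible n k C (s 18).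
Proof.
move=> es; rewrite /FEAS den_seq; set s1 := den _ s.
have es1 : env s1 by apply: env_den es.
set p := PFor _ _ _.
have h0 : den p s1 22 0 != 0 <->
    forall b, b < eval s1 nE -> b < k -> load n (s 18) b <= C; last first.
  apply: (iff_trans h0); rewrite eval_nE //.
  by split=> h b bk; [apply: h; lia | exact: h].
apply: (@den_for (fun i s' => s' 22 0 != 0 <->
                     forall b, b < i -> b < k -> load n (s 18) b <= C)) => //.
  by move=> s' e; rewrite e // /s1 den_set update_eq.
move=> i s' s'' ; rewrite eval_nE // => ni ci fr e IH.
have es' : env s' by apply: env_frame fr _ es1.
rewrite e // den_when eval_ltE eval_kE // [eval _ _]/= ci.
case: ltnP => ik; last first.
  apply: (iff_trans IH); split=> h b bi bk; apply: h => //; last exact: ltnW.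
  by move: bi; rewrite ltnS leq_eqVlt => /predU1P[e'|//]; lia.
rewrite !den_seq; set s2 := den _ s'; set s3 := den _ s2.
have es2 : env s2 by apply: env_den es'.
have es3 : env s3 by apply: env_den es2.
have l3 : s3 23 0 = load n (s 18) i.
  rewrite /load; have -> : n = eval s2 nE by rewrite eval_nE.
  apply: (@den_for (fun j t => t 23 0 = \sum_(x < j) (s 18 x == i))) => //.
    by move=> t et; rewrite et // big_ord0.
  move=> j t t''; rewrite eval_nE // => nj cj frt et IHt.
  rewrite et // big_ord_recr /= -IHt den_when eval_eqE /= cj.
  rewrite [t 18]frt // [t 33]frt // /s2 den_frame // den_frame // fr // ci.
  rewrite /s1 den_frame //.
  by case: eqP => _ /=; rewrite ?den_set ?update_eq // addn0.
rewrite den_when eval_ltE.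
have -> : eval s3 cE = C by rewrite /= es3.
rewrite [eval _ _]/= l3.
have e22 : s3 22 0 = s' 22 0 by rewrite /s3 den_frame // /s2 den_frame.
case: ltnP => lC.
  rewrite den_set update_eq /=; split=> // h.
  by have := h i (ltnSn i) ik; lia.
rewrite e22; apply: (iff_trans IH); split=> h b bi bk; last by apply: h => //; apply: ltnW.
by move: bi; rewrite ltnS leq_eqVlt => /predU1P[->//|bi]; apply: h.
Qed.


Lemma eval_freeE s e x : env s -> eval s e = x -> x < n ->
  (eval s (Sub (Const 1) (Get 6 e)) != 0) = ~~ inU x.
Proof. by move=> es ex xn; rewrite eval_ltE /= ex es // e0U //; case: (inU x). Qed.

(** Storing the best value plus one lets 0 mean that no movable vertex of block b has been seen,
    even when values are 0. *)
Lemma moverP s v b : env s -> s 38 0 = v -> s 36 0 = b ->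
  let s' := den MOVER s in let upd_val x := aval n k W (upd (s 14) x (s 13 b)) in
  (s' 20 0 = 0 /\ forall x, x < n -> movable inU v x -> s 14 x != b) \/
  [/\ s' 20 0 = (upd_val (s' 21 0)).+1, s' 21 0 < n, movable inU v (s' 21 0),
      s 14 (s' 21 0) = b &
      forall x, x < n -> movable inU v x -> s 14 x = b -> upd_val x < s' 20 0].
Proof.
move=> es sv sb s' uv; rewrite /s' /MOVER den_seq; set s1 := den _ s.
have es1 : env s1 by apply: env_den es.
set p := PFor _ _ _.
pose Inv i (t : state) :=
  (t 20 0 = 0 /\ forall x, x < i -> movable inU v x -> s 14 x != b) \/
  [/\ t 20 0 = (uv (t 21 0)).+1, t 21 0 < n, movable inU v (t 21 0),
      s 14 (t 21 0) = b &
      forall x, x < i -> movable inU v x -> s 14 x = b -> uv x < t 20 0].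
suff : Inv n (den p s1) by [].
rewrite -[n in Inv n](eval_nE es1); apply: den_for => //.
  by move=> t et; left; split=> //; rewrite et // /s1 den_set update_eq.
move=> i t t''; rewrite eval_nE // => ni ci fr et IH.
have est : env t by apply: env_frame fr _ es1.
have t38 : t 38 0 = v by rewrite fr // /s1 den_frame.
have t36 : t 36 0 = b by rewrite fr // /s1 den_frame.
have t14 : t 14 = s 14 by rewrite fr // /s1 den_frame.
have t13 : t 13 = s 13 by rewrite fr // /s1 den_frame.
have skip : t'' 20 0 = t 20 0 -> t'' 21 0 = t 21 0 ->
    ~ (movable inU v i /\ s 14 i = b) -> Inv i.+1 t''.
  move=> e20 e21 nm; rewrite /Inv e20 e21; case: IH => [[z h]|[h1 h2 h3 h4 h5]].
    left; split=> // x; rewrite ltnS leq_eqVlt => /predU1P[->|]; last exact: h.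
    by move=> mx; apply/eqP => ex; apply: nm.
  right; split=> // x; rewrite ltnS leq_eqVlt => /predU1P[->|]; last exact: h5.
  by move=> mx ex; case: nm.
move: (congr1 (@^~ 0) (et 20 isT)) (congr1 (@^~ 0) (et 21 isT)).
rewrite !den_when eval_ltE (eval_freeE est _ ni) // eval_eqE.
rewrite [eval t (Var _)]/= [eval t (Var _)]/=.
rewrite [eval _ _]/= ci t38 [eval _ _]/= t36 t14.
case: ltnP => iv; last first.
  by move=> e20 e21; apply: skip => //; rewrite /movable; lia.
case Ui: (inU i) => /=.
  by move=> e20 e21; apply: skip => //; rewrite /movable Ui; case.
case: eqP => /= ib; last by move=> e20 e21; apply: skip => // -[].
rewrite 3!den_seq; set t1 := den _ t; set t2 := den _ t1; set t3 := den _ t2.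
have est1 : env t1 by apply: env_den est.
have est2 : env t2 by apply: env_den est1.
have t3v : t3 19 0 = uv i.
  rewrite /t3 val_progP //; apply: eq_aval => x xn.
  have t135 : t1 35 0 = i by rewrite /t1 den_frame.
  have t136 : t1 36 0 = b by rewrite /t1 den_frame.
  have t113 : t1 13 = s 13 by rewrite /t1 den_frame.
  rewrite /t2 den_assign update_same /= t135 t136 t113 /upd.
  by rewrite /t1 copyP ?t14 // est // e0n.
have t320 : t3 20 0 = t 20 0 by rewrite /t3 !den_frame // /t2 den_frame // /t1 den_frame.
have t321 : t3 21 0 = t 21 0 by rewrite /t3 !den_frame // /t2 den_frame // /t1 den_frame.
have t335 : t3 35 0 = i by rewrite /t3 !den_frame // /t2 den_frame // /t1 den_frame.
rewrite den_when eval_ltE [eval t3 _]/= [eval t3 _]/= t3v t320 addn1.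
have mi : movable inU v i by rewrite /movable Ui iv.
case: ltnP => lt.
  rewrite den_seq !den_set update_eq update_neq // update_eq /=.
  rewrite update_neq // t335 t3v addn1 => e20 e21; right.
  rewrite e20 e21; split=> // x; rewrite ltnS leq_eqVlt => /predU1P[->//|xi] mx ex.
  case: IH => [[_ h]|[_ _ _ _ h]]; last by have := h x xi mx ex; lia.
  by move: (h x xi mx); rewrite ex eqxx.
rewrite t320 t321 => e20 e21; right; rewrite e20 e21.
case: IH => [[z _]|[h1 h2 h3 h4 h5]]; first by lia.
split=> // x; rewrite ltnS leq_eqVlt => /predU1P[->|]; last exact: h5.
by move=> _ _; lia.
Qed.

Lemma candP s v : env s -> s 38 0 = v -> v < n ->
  exists m, (forall b, b < k -> best_mover n k W inU v (s 14) (s 13) m b) /\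
    forall x, x < n -> den CAND s 17 x = reassign k (s 14) v (s 13) m x.
Proof.
move=> es sv vn; rewrite /CAND !den_seq; set s1 := den _ s; set s2 := den _ s1.
have es1 : env s1 by apply: env_den es.
have es2 : env s2 by apply: env_den es1.
pose Inv i (t : state) := exists m,
  (forall b, b < i -> b < k -> best_mover n k W inU v (s 14) (s 13) m b) /\
  forall x, x < n -> t 17 x = shift (s 14) (s 13) m (minn i k) x.
suff : Inv n s2.
  move=> [m [h1 h2]]; exists m; split=> [b bk|x xn]; first by apply: h1; lia.
  rewrite den_assign update_same /= (es2 7) // e0k.
  have -> : s2 38 0 = v by rewrite /s2 den_frame // /s1 den_frame.
  have -> : s2 13 = s 13 by rewrite /s2 den_frame // /s1 den_frame.
  by rewrite /reassign /upd h2 // (minn_idPr kn).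
rewrite -[n in Inv n](eval_nE es1); apply: den_for => //.
  move=> t et; exists id; split=> // x xn; rewrite et // min0n /shift /=.
  by rewrite /s1 copyP // es // e0n.
move=> i t t''; rewrite eval_nE // => ni ci fr et [m [IH1 IH2]].
have est : env t by apply: env_frame fr _ es1.
have t38 : t 38 0 = v by rewrite fr // /s1 den_frame.
have t14 : t 14 = s 14 by rewrite fr // /s1 den_frame.
have t13 : t 13 = s 13 by rewrite fr // /s1 den_frame.
move: (et 17 isT); rewrite den_when eval_ltE eval_kE // [eval _ _]/= ci.
case: ltnP => ik; last first.
  move=> e17; exists m; split=> [b bi bk|x xn]; first by apply: IH1; lia.
  by rewrite e17 IH2 //; congr (shift _ _ _ _ x); lia.
have := moverP est t38 ci; rewrite den_seq t14 t13; set t1 := den MOVER t => mP.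
have t117 : t1 17 = t 17 by rewrite /t1 den_frame.
have t136 : t1 36 0 = i by rewrite /t1 den_frame.
have t113 : t1 13 = s 13 by rewrite /t1 den_frame.
rewrite den_when [eval _ _]/=.
(* Cell 21 may hold a leftover of an earlier block when no mover was found; m then takes the default
   n. *)
pose m' c := if c == i then if t1 20 0 == 0 then n else t1 21 0 else m c.
have bm b : b < i.+1 -> b < k -> best_mover n k W inU v (s 14) (s 13) m' b.
  rewrite ltnS leq_eqVlt => /predU1P[-> _|bi bk]; last first.
    case: (IH1 b bi bk) => [[h1 h2]|[h1 h2]]; [left | right];
      by rewrite /move_from /m' ltn_eqF.
  rewrite /best_mover /move_from /m' eqxx.
  case: mP => [[z h]|[h1 h2 h3 h4 h5]]; first by right; rewrite z eqxx.
  left; rewrite h1 /=; split=> // x xn mx ex.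
  by have := h5 x xn mx ex; rewrite h1 ltnS.
move=> e17; exists m'; split=> // x xn.
have mE : minn i.+1 k = i.+1 by apply/minn_idPl.
have mE' : minn i k = i by apply/minn_idPl; apply: ltnW.
have -> : t'' 17 x = if (t1 20 0 != 0) && (x == t1 21 0) then s 13 i else t 17 x.
  rewrite e17; case: eqP => /= _; first by rewrite t117.
  by rewrite den_assign update_same /= t136 t113 t117.
rewrite IH2 // mE mE' /shift /m' ltnS [s 14 x <= i]leq_eqVlt.
have [fi|fi] := eqVneq (s 14 x) i; last first.
  rewrite orFb; case: mP => [[-> _]|[-> _ _ h _]] //=.
  by case: eqP => // ex; move: fi; rewrite ex h eqxx.
by rewrite fi ltnn /=; case: eqP => //= _; rewrite ltn_eqF.
Qed.


(** Radix 1 freezes a digit at 0. So the odometers can run over all n vertices, or n+1 labels, and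
    still take only (k+1)^k, or (k+1)^(k+1), values. *)
Definition radix_cover x := if inU x then k.+1 else 1.
Definition radix_block i := if i <= k then k.+1 else 1.

Hypothesis coverW : forall x y, x < n -> y < n -> ~~ inU x -> ~~ inU y -> W x y = 0.
Hypothesis e0M : e0 8 0 = k.+1 ^ k.+1.
Hypothesis e0R1 : forall x, x < n -> e0 10 x = radix_cover x.
Hypothesis e0R2 : forall i, i < n.+1 -> e0 11 i = radix_block i.
Hypothesis card_cover : \sum_(x < n) inU x = k.

Lemma place_block : place radix_block n.+1 = k.+1 ^ k.+1.
Proof.
suff h i : place radix_block i = k.+1 ^ minn i k.+1.
  by rewrite h (minn_idPr _).
elim: i => [|i IH]; first by rewrite /place big_ord0 min0n.
rewrite placeS IH /radix_block; case: leqP => ik.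
  by rewrite (minn_idPl (leqW ik)) (minn_idPl _) // expnSr.
by rewrite muln1 !(minn_idPr _) // leqW.
Qed.

(** Both enumerations share the loop bound (k+1)^(k+1). The odometer of labellings may wrap around
    within it, and then labellings are merely repeated. *)
Lemma place_cover : place radix_cover n <= k.+1 ^ k.+1.
Proof.
suff -> : place radix_cover n = k.+1 ^ (\sum_(x < n) inU x).
  by rewrite card_cover leq_pexp2l.
elim: (n) => [|i IH]; first by rewrite /place !big_ord0.
rewrite placeS IH big_ord_recr /= expnD /radix_cover.
by case: (inU i); rewrite ?expn1.
Qed.

(** One greedy candidate stands for all choices of movers for the same H: if any choice is feasible,
    so is the greedy one, with at least the same value. *)
Lemma tryP s v base : env s -> s 38 0 = v -> v < n -> ~~ inU v -> base v = k ->
    optimal n k C W base (movable inU v) (s 14) ->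
    (forall b, b <= k -> s 13 b <= k) ->
    admissible n k C base (movable inU v.+1) (s 15) ->
    s 16 0 = aval n k W (s 15) ->
  let s' := den TRY s in
  [/\ admissible n k C base (movable inU v.+1) (s' 15),
      s' 16 0 = aval n k W (s' 15), s 16 0 <= s' 16 0 &
      forall m, (forall b, b < k -> s 13 b != b -> move_from n inU v (s 14) m b) ->
        feasible n k C (reassign k (s 14) v (s 13) m) ->
        aval n k W (reassign k (s 14) v (s 13) m) <= s' 16 0].
Proof.
move=> es sv vn vU bv op H13 ad15 e16 s'.
have [m [bm em]] := candP es sv vn.
rewrite /s' /TRY; rewrite 4!den_seq.
set s1 := den CAND s in em *; set s2 := den _ s1; set s3 := den _ s2; set s4 := den _ s3.
have es1 : env s1 by apply: env_den es.
have es2 : env s2 by apply: env_den es1.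
have es3 : env s3 by apply: env_den es2.
have s218 x : x < n -> s2 18 x = reassign k (s 14) v (s 13) m x.
  by move=> xn; rewrite /s2 copyP ?em // es1 // e0n.
have s417 x : x < n -> s4 17 x = reassign k (s 14) v (s 13) m x.
  by move=> xn; rewrite /s4 den_frame // /s3 den_frame // /s2 den_frame // em.
have s419 : s4 19 0 = aval n k W (reassign k (s 14) v (s 13) m).
  rewrite /s4 val_progP //; apply: eq_aval => x xn.
  by rewrite /s3 den_frame // s218.
have s422 : s4 22 0 != 0 <-> feasible n k C (reassign k (s 14) v (s 13) m).
  rewrite /s4 den_frame // /s3; apply: (iff_trans (feasP es2)).
  by split; apply: eq_feasible => x xn; rewrite s218.
have s416 : s4 16 = s 16.
  by rewrite /s4 den_frame // /s3 den_frame // /s2 den_frame // /s1 den_frame.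
have s415 : s4 15 = s 15.
  by rewrite /s4 den_frame // /s3 den_frame // /s2 den_frame // /s1 den_frame.
have best m0 : (forall b, b < k -> s 13 b != b -> move_from n inU v (s 14) m0 b) ->
    feasible n k C (reassign k (s 14) v (s 13) m0) ->
    s4 22 0 != 0 /\ aval n k W (reassign k (s 14) v (s 13) m0) <= s4 19 0.
  move=> h0 fe; have [fm le] := reassign_best coverW vn vU bv op h0 bm fe.
  by split; [apply/s422 | rewrite s419].
rewrite !den_when eval_ltE [eval s4 _]/= [eval s4 _]/= [eval s4 _]/= s416.
case f4: (s4 22 0 != 0); last first.
  rewrite s415 s416; split=> // m0 h0 fe.
  by have [+ _] := best m0 h0 fe; rewrite f4.
case: ltnP => lt; last first.
  rewrite s415 s416; split=> // m0 h0 fe.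
  by have [_ le] := best m0 h0 fe; apply: leq_trans le lt.
rewrite den_seq; set s5 := den _ s4; set s6 := den _ s5.
have es5 : env s5 by do 2 apply: env_den => //.
have s615 x : x < n -> s6 15 x = reassign k (s 14) v (s 13) m x.
  by move=> xn; rewrite /s6 copyP ?(es5 0) ?e0n // /s5 den_frame // s417.
have s616 : s6 16 0 = s4 19 0 by rewrite /s6 den_frame // /s5 den_set update_eq.
have adr := reassign_admissible vn vU bv op H13 bm ((s422.1) f4).
split.
- by apply: eq_admissible adr => x xn; rewrite s615.
- by rewrite s616 s419; apply: eq_aval => x xn; rewrite s615.
- by rewrite s616; apply: ltnW.
- by move=> m0 h0 fe; rewrite s616; case: (best m0 h0 fe).
Qed.

Lemma eval_n1E s : env s -> eval s n1E = n.+1.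
Proof. by move=> es; rewrite /= es // e0n addn1. Qed.

Lemma eval_mE s : env s -> eval s mE = k.+1 ^ k.+1.
Proof. by move=> es; rewrite /= es // e0M. Qed.

Lemma stageP s v base : env s -> s 38 0 = v -> v < n -> ~~ inU v -> base v = k ->
    optimal n k C W base (movable inU v) (s 14) ->
  optimal n k C W base (movable inU v.+1) (den STAGE s 14).
Proof.
move=> es sv vn vU bv op; rewrite /STAGE 6!den_seq.
set s1 := den _ s; set s2 := den _ s1; set s3 := den _ s2; set s4 := den _ s3.
set s5 := den _ s4; set s6 := den _ s5.
have es1 : env s1 by apply: env_den es.
have es2 : env s2 by apply: env_den es1.
have es3 : env s3 by apply: env_den es2.
have es4 : env s4 by apply: env_den es3.
have es5 : env s5 by apply: env_den es4.
have es6 : env s6 by apply: env_den es5.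
have fr5 b : b \notin [:: 30; 15; 18; 19; 31; 32; 16; 13; 42] -> s5 b = s b.
  rewrite !inE !negb_or => h.
  rewrite /s5 den_frame /= ?inE; last by lia.
  rewrite /s4 den_frame /= ?inE; last by lia.
  rewrite /s3 den_frame /= ?inE; last by lia.
  rewrite /s2 den_frame /= ?inE; last by lia.
  by rewrite /s1 den_frame /= ?inE; last by lia.
set f := s 14 in op *.
pose Inv q (t : state) := [/\ digits radix_block n.+1 (t 13),
  q < k.+1 ^ k.+1 -> digits_value radix_block n.+1 (t 13) = q,
  admissible n k C base (movable inU v.+1) (t 15),
  t 16 0 = aval n k W (t 15) &
  forall H m, digits radix_block n.+1 H -> digits_value radix_block n.+1 H < q ->
    (forall b, b < k -> H b != b -> move_from n inU v f m b) ->
    feasible n k C (reassign k f v H m) ->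
    aval n k W (reassign k f v H m) <= t 16 0].
suff : Inv (k.+1 ^ k.+1) s6.
  move=> [_ _ ad6 e16 cv].
  have e14 x : x < n -> den (COPY 14 15) s6 14 x = s6 15 x.
    by move=> xn; rewrite copyP // es6 // e0n.
  split; first by apply: eq_admissible ad6 => x xn; rewrite e14.
  move=> g adg; rewrite (eq_aval _ _ e14) -e16.
  have [H [m [h1 h2 h3 h4]]] := augmentation coverW vn vU bv op adg.
  (* The digits above k have radix 1, so H must be cut to 0 there before it can occur in the
     enumeration. *)
  pose H' i := if i <= k then H i else 0.
  have eH x : reassign k f v H m x = reassign k f v H' m x.
    rewrite /reassign /upd /shift /H' leqnn; case: eqP => // _.
    by case: ltnP => //= xk; rewrite ltnW.
  have dH : digits radix_block n.+1 H'.
    move=> i _; rewrite /H' /radix_block; case: (leqP i k) => // ik.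
    by rewrite ltnS h1.
  apply: leq_trans h4 _; rewrite (@eq_aval _ _ _ _ (reassign k f v H' m)) //.
  apply: cv => //.
  - by rewrite -place_block digits_value_lt.
  - by move=> b bk; rewrite /H' ltnW //; apply: h2.
  - by apply: eq_feasible h3.
rewrite -(eval_mE es5); apply: den_for => //.
  move=> t et; split.
  - move=> i ni; rewrite et // /s5 zeroP ?eval_n1E //.
    by rewrite /radix_block; case: ifP.
  - move=> _; rewrite et // /digits_value big1 // => i _.
    by rewrite /s5 zeroP ?eval_n1E.
  (* The search starts from f itself: with v left at label k it is admissible after the insertion
     too. *)
  - have -> : t 15 = s1 15.
      rewrite et // /s5 den_frame // /s4 den_frame // /s3 den_frame //.
      by rewrite /s2 den_frame.
    have e1 x : x < n -> f x = s1 15 x by move=> xn; rewrite /s1 copyP // es // e0n.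
    apply: (eq_admissible e1); case: op => -[o1 o2 o3] _; split=> // x xn mx.
    apply: o2 => //; apply: contra mx; rewrite /movable => /andP[-> /=]; lia.
  - have -> : t 16 0 = s3 19 0.
      by rewrite et // /s5 den_frame // /s4 den_set update_eq.
    rewrite /s3 val_progP //; apply: eq_aval => x xn.
    rewrite et // /s5 den_frame // /s4 den_frame // /s3 den_frame //.
    rewrite /s2 [in RHS]den_frame // copyP //; last by rewrite es1 // e0n.
    by rewrite /s1 den_frame // copyP // es // e0n.
  - by [].
move=> q t t''; rewrite eval_mE // => qM cq fr et [d13 v13 ad15 e16 cv].
have est : env t by apply: env_frame fr _ es5.
have t14 : t 14 = f by rewrite fr // fr5.
have t38 : t 38 0 = v by rewrite fr // fr5.
have t13k b : b <= k -> t 13 b <= k.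
  by move=> bk; have := d13 b; rewrite /radix_block bk !ltnS; apply; lia.
rewrite -t14 in op.
have [a15 b16 c16 cv'] := tryP est t38 vn vU bv op t13k ad15 e16.
move: (et 13 isT) (et 15 isT) (et 16 isT); rewrite den_seq; set t1 := den TRY t.
have est1 : env t1 by apply: env_den est.
have t113 : t1 13 = t 13 by rewrite /t1 den_frame.
have := @incrP 13 11 n1E t1 radix_block; rewrite eval_n1E // t113.
case=> // [i ni|dI vI]; first by rewrite est1 // e0R2.
move=> e13 e15 e16'.
rewrite [den (INCR _ _ _) _ 15]den_frame // in e15.
rewrite [den (INCR _ _ _) _ 16]den_frame // in e16'.
split.
- by rewrite e13.
- by move=> qM1; rewrite e13 vI v13 // place_block.
- by rewrite e15.
- by rewrite e15 e16'.
move=> H m dH; rewrite ltnS leq_eqVlt e16' => /predU1P[eq|lt] hm fe; last first.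
  by apply: leq_trans c16; apply: cv.
have eH : forall i, i < n.+1 -> H i = t 13 i.
  by apply: (digits_value_inj dH d13); rewrite v13.
have eR x : reassign k f v H m x = reassign k (t 14) v (t 13) m x.
  rewrite t14 /reassign /upd /shift eH //; case: eqP => // _.
  by case: ltnP => //= xk; rewrite eH //; lia.
rewrite (@eq_aval _ _ _ _ (reassign k (t 14) v (t 13) m)) //.
apply: cv'; last by apply: eq_feasible fe.
by move=> b bk; rewrite -eH ?t14; [apply: hm | lia].
Qed.

Definition cover_base (F : nat -> nat) x := if inU x then F x else k.

Lemma initP s : env s -> forall x, x < n -> den INIT s 14 x = cover_base (s 12) x.
Proof.
move=> es.
suff : forall x, x < eval s nE -> den INIT s 14 x = cover_base (s 12) x.
  by rewrite eval_nE.
apply: (@den_for (fun i t => forall x, x < i -> t 14 x = cover_base (s 12) x)) => //.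
move=> i t t''; rewrite eval_nE // => ni ci fr et IH x xi.
have est : env t by apply: env_frame fr _ es.
have ek : eval t kE = k by rewrite eval_kE.
rewrite et // den_if /= ci (est 6) // e0U //.
have [->|xn] := eqVneq x i; last first.
  have lt : x < i by lia.
  by case: (inU i); rewrite /= den_assign update_same /= ci (negPf xn) IH.
rewrite /cover_base; case: (inU i); rewrite /= den_assign update_same /= ci eqxx.
  by rewrite fr.
exact: ek.
Qed.

Lemma optimal_movable0 base f : (forall x, x < n -> f x = base x) ->
  (forall x, x < n -> base x <= k) -> feasible n k C f ->
  optimal n k C W base (movable inU 0) f.
Proof.
move=> e bk fe; split; first by split=> // x xn; rewrite e // bk.
move=> g [_ h _]; rewrite (@eq_aval _ _ _ _ f) // => x xn.
by rewrite e // h // /movable ltn0 andbF.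
Qed.

Lemma solveP s : env s -> digits radix_cover n (s 12) ->
    (s 25 0 = 0 \/ [/\ forall x, x < n -> s 24 x <= k, feasible n k C (s 24) &
                       s 25 0 = (aval n k W (s 24)).+1]) ->
  let s' := den SOLVE s in
  [/\ s' 25 0 = 0 \/ [/\ forall x, x < n -> s' 24 x <= k, feasible n k C (s' 24) &
                       s' 25 0 = (aval n k W (s' 24)).+1],
      s 25 0 <= s' 25 0 &
      forall g, (forall x, x < n -> g x <= k) -> feasible n k C g ->
        (forall x, x < n -> inU x -> g x = s 12 x) -> aval n k W g < s' 25 0].
Proof.
move=> es d12 h25 s'; rewrite /s' /SOLVE; rewrite 3!den_seq.
set s1 := den _ s; set s2 := den _ s1; set s3 := den _ s2.
have es1 : env s1 by apply: env_den es.
have es2 : env s2 by apply: env_den es1.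
have es3 : env s3 by apply: env_den es2.
set base := cover_base (s 12).
have basek x : x < n -> base x <= k.
  move=> xn; rewrite /base /cover_base; case Ux: (inU x) => //.
  by have := d12 x xn; rewrite /radix_cover Ux ltnS.
have s218 x : x < n -> s2 18 x = base x.
  by move=> xn; rewrite /s2 copyP ?(es1 0) ?e0n // /s1 initP.
have s314 x : x < n -> s3 14 x = base x.
  by move=> xn; rewrite /s3 den_frame // /s2 den_frame // /s1 initP.
have s322 : s3 22 0 != 0 <-> feasible n k C base.
  by apply: (iff_trans (feasP es2)); split; apply: eq_feasible => x xn; rewrite s218.
have s324 : s3 24 = s 24 by rewrite /s3 den_frame // /s2 den_frame // /s1 den_frame.
have s325 : s3 25 = s 25 by rewrite /s3 den_frame // /s2 den_frame // /s1 den_frame.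
(* Waiting vertices use no capacity, so a labelling of the cover that extends to a feasible g is
   itself feasible. Rejecting infeasible ones loses nothing. *)
have bfe g : feasible n k C g -> (forall x, x < n -> inU x -> g x = s 12 x) ->
    feasible n k C base.
  move=> fg gU b bk; apply: leq_trans (fg b bk); apply: leq_sum => x _.
  rewrite /base /cover_base; case Ux: (inU x); first by rewrite gU.
  by rewrite gtn_eqF.
rewrite den_when [eval s3 _]/=; case f3: (s3 22 0 != 0); last first.
  rewrite s324 s325; split=> // g gk fg gU.
  by have := s322.2 (bfe g fg gU); rewrite f3.
have fb := s322.1 f3.
rewrite 3!den_seq; set s4 := den _ s3; set s5 := den _ s4; set s6 := den _ s5.
have es4 : env s4 by apply: env_den es3.
have es5 : env s5 by apply: env_den es4.
have es6 : env s6 by apply: env_den es5.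
have op : optimal n k C W base (movable inU n) (s4 14).
  rewrite -[n in movable inU n](eval_nE es3).
  apply: (@den_for (fun v t => optimal n k C W base (movable inU v) (t 14))) => //.
    move=> t et; rewrite et //; apply: optimal_movable0 => //.
    by apply: eq_feasible fb => x xn; rewrite s314.
  move=> v t t''; rewrite eval_nE // => vn cv fr et IH.
  have est : env t by apply: env_frame fr _ es3.
  rewrite et // den_when (eval_freeE est _ vn) //.
  case Uv: (inU v) => /=; last first.
    by apply: stageP => //; rewrite ?Uv // /base /cover_base Uv.
  (* A cover vertex never moves, so its turn leaves the optimisation problem unchanged. *)
  have em x : movable inU v.+1 x = movable inU v x.
    rewrite /movable ltnS leq_eqVlt; case: eqP => //= ->.
    by rewrite Uv.
  case: IH => -[o1 o2 o3] o4; split; first by split=> // x xn; rewrite em; apply: o2.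
  move=> g [g1 g2 g3]; apply: o4; split=> // x xn mx; apply: g2 => //.
  by rewrite em.
have s519 : s6 19 0 = aval n k W (s4 14).
  rewrite /s6 val_progP //; apply: eq_aval => x xn.
  by rewrite /s5 copyP // es4 // e0n.
have s625 : s6 25 = s 25 by rewrite /s6 den_frame // /s5 den_frame // /s4 den_frame.
have s624 : s6 24 = s 24 by rewrite /s6 den_frame // /s5 den_frame // /s4 den_frame.
have cov g : (forall x, x < n -> g x <= k) -> feasible n k C g ->
    (forall x, x < n -> inU x -> g x = s 12 x) -> aval n k W g <= s6 19 0.
  move=> gk fg gU; rewrite s519; apply: op.2; split=> // x xn.
  rewrite /movable xn andbT negbK => Ux.
  by rewrite gU // /base /cover_base Ux.
rewrite den_when eval_ltE [eval s6 _]/= [eval s6 _]/= addn1 s625.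
case: ltnP => lt; last first.
  rewrite s624 s625; split=> // g gk fg gU.
  by apply: leq_trans lt; rewrite ltnS; apply: cov.
rewrite den_seq; set s7 := den _ s6; set s8 := den _ s7.
have es7 : env s7 by apply: env_den es6.
have e24 x : x < n -> s4 14 x = s8 24 x.
  move=> xn; rewrite /s8 copyP ?(es7 0) ?e0n // /s7 den_frame // /s6 den_frame //.
  by rewrite /s5 den_frame.
have e25 : s8 25 0 = (s6 19 0).+1.
  by rewrite /s8 den_frame // /s7 den_set update_eq /= addn1.
split.
- right; case: op => -[o1 o2 o3] _; split.
  + by move=> x xn; rewrite -e24 // o1.
  + exact: eq_feasible o3.
  + by rewrite e25 s519 (eq_aval _ _ e24).
- by rewrite e25; apply: ltnW.
- by move=> g gk fg gU; rewrite e25 ltnS cov.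
Qed.

Lemma mainP s : env s -> (forall x, x < n -> s 12 x = 0) -> s 25 0 = 0 ->
  let s' := den MAIN s in
  [/\ forall x, x < n -> s' 24 x <= k, feasible n k C (s' 24) &
      forall g, (forall x, x < n -> g x <= k) -> feasible n k C g ->
        aval n k W g <= aval n k W (s' 24)].
Proof.
move=> es z12 z25 s'; rewrite /s' /MAIN.
pose Inv i (t : state) := [/\ digits radix_cover n (t 12),
  i < place radix_cover n -> digits_value radix_cover n (t 12) = i,
  t 25 0 = 0 \/ [/\ forall x, x < n -> t 24 x <= k, feasible n k C (t 24) &
                    t 25 0 = (aval n k W (t 24)).+1] &
  forall F, digits radix_cover n F -> digits_value radix_cover n F < i ->
    forall g, (forall x, x < n -> g x <= k) -> feasible n k C g ->
      (forall x, x < n -> inU x -> g x = F x) -> aval n k W g < t 25 0].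
have [_ _ h25 cv] : Inv (k.+1 ^ k.+1) (den MAIN s); last first.
  have cover g : (forall x, x < n -> g x <= k) -> feasible n k C g ->
      aval n k W g < den MAIN s 25 0.
    move=> gk fg; pose F x := if inU x then g x else 0.
    have dF : digits radix_cover n F.
      move=> x xn; rewrite /F /radix_cover; case: (inU x) => //.
      by rewrite ltnS gk.
    apply: (cv F) => //.
      by apply: leq_trans place_cover; apply: digits_value_lt.
    by move=> x xn Ux; rewrite /F Ux.
  case: h25 => [z|[h1 h2 h3]]; last first.
    by split=> // g gk fg; have := cover g gk fg; rewrite h3 ltnS.
  (* The assignment of label k to every vertex is always feasible, so the search has found
     something. *)
  suff : feasible n k C (fun=> k).
    by move=> /(cover (fun=> k) (fun x _ => leqnn k)); rewrite z.
  by move=> b bk; rewrite /load big1 // => x _; rewrite gtn_eqF.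
rewrite -(eval_mE es); apply: den_for => //.
  move=> t et; split=> //.
  - move=> x xn; rewrite et // z12 // /radix_cover; by case: ifP.
  - by move=> _; rewrite et // /digits_value big1 // => x _; rewrite z12.
  - by left; rewrite et.
move=> i t t''; rewrite eval_mE // => iM ci fr et [d12 v12 h25 cv].
have est : env t by apply: env_frame fr _ es.
have [a25 m25 c25] := solveP est d12 h25.
move: (et 12 isT) (et 24 isT) (et 25 isT); rewrite den_seq; set t1 := den SOLVE t.
have est1 : env t1 by apply: env_den est.
have t112 : t1 12 = t 12 by rewrite /t1 den_frame.
have := @incrP 12 10 nE t1 radix_cover; rewrite eval_nE // t112.
case=> // [x xn|dI vI]; first by rewrite est1 // e0R1.
move=> e12 e24 e25.
rewrite [den (INCR _ _ _) _ 24]den_frame // in e24.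
rewrite [den (INCR _ _ _) _ 25]den_frame // in e25.
split.
- by rewrite e12.
- by move=> iP; rewrite e12 vI v12 //; apply: ltnW.
- by rewrite e24 e25.
move=> F dF; rewrite ltnS leq_eqVlt e25 => /predU1P[eqi|lt] g gk fg gF; last first.
  by apply: leq_trans m25; apply: (cv F).
apply: c25 => // x xn Ux; rewrite gF //.
apply: (digits_value_inj dF d12) => //; rewrite v12 // -eqi.
exact: digits_value_lt.
Qed.

End Machine.

(** * Preprocessing and output *)

(** The machine cannot multiply, so the offsets [x * n] are tabulated by repeated addition. *)
Definition ROWS := PFor 43 nE
  (PAssign 5 (Add (Var 43) (Const 1)) (Add (Get 5 (Var 43)) nE)).

Definition MATCH_ROW := PFor 45 nE
  (When (Get 1 (Add (Get 5 (Var 44)) (Var 45)))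
  (When (Sub (Const 1) (Get 6 (Var 44)))
  (When (Sub (Const 1) (Get 6 (Var 45)))
    (PAssign 6 (Var 44) (Const 1) ;; PAssign 6 (Var 45) (Const 1) ;;
     SetVar 7 (Add kE (Const 2)))))).

Definition MATCH := PFor 44 nE MATCH_ROW.

(** The inner loop multiplies cell 8 by k+1 through repeated addition. *)
Definition POWER :=
  SetVar 8 (Const 1) ;;
  PFor 46 n1E (When (Sub (Add kE (Const 1)) (Var 46))
    (SetVar 9 (Const 0) ;;
     PFor 47 n1E (When (Sub (Add kE (Const 1)) (Var 47))
       (SetVar 9 (Add (Var 9) mE))) ;;
     SetVar 8 (Var 9))).

Definition RADIX1 := PFor 48 nE (PIf (Get 6 (Var 48))
  (PAssign 10 (Var 48) (Add kE (Const 1))) (PAssign 10 (Var 48) (Const 1))).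

Definition RADIX2 := PFor 49 n1E (PIf (Sub (Add kE (Const 1)) (Var 49))
  (PAssign 11 (Var 49) (Add kE (Const 1))) (PAssign 11 (Var 49) (Const 1))).

Definition PRE := ROWS ;; MATCH ;; POWER ;; RADIX1 ;; RADIX2.

(** The labels k + x are pairwise distinct and at least k, which turns the vertices with label k
    into singletons. The flag is set when C > 0 or n = 0, which is when a C-partition exists. *)
Definition OUT :=
  PFor 50 nE (PIf (Sub kE (Get 24 (Var 50)))
    (PAssign 3 (Var 50) (Get 24 (Var 50)))
    (PAssign 3 (Var 50) (Add kE (Var 50)))) ;;
  PIf cE (SetVar 4 (Const 1)) (PIf nE PSkip (SetVar 4 (Const 1))).

Lemma rowsP s : s 5 0 = 0 -> forall x, x <= s 0 0 -> den ROWS s 5 x = x * s 0 0.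
Proof.
move=> z5; rewrite -{1}[s 0 0]/(eval s nE).
apply: (@den_for (fun i t => forall x, x <= i -> t 5 x = x * s 0 0)) => //.
  by move=> t et x; rewrite leqn0 => /eqP ->; rewrite et.
move=> i t t'' ni ci fr et IH x xi; rewrite et // den_assign update_same /= ci.
case: eqP => [->|ne]; last by apply: IH; lia.
by rewrite IH // (fr 0) // addn1 mulSn addnC.
Qed.

Lemma sum_upd n (G : nat -> nat -> nat) f i b : i < n ->
  \sum_(x < n) G x (upd f i b x) + G i (f i) = \sum_(x < n) G x (f x) + G i b.
Proof.
move=> ni; rewrite (bigD1 (Ordinal ni)) //= [in RHS](bigD1 (Ordinal ni)) //=.
rewrite {1}/upd eqxx; set A := (X in _ + X + _ = _); set B := (X in _ = _ + X + _).
suff -> : A = B by lia.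
by apply: eq_bigr => y; rewrite -val_eqE /= /upd => /negPf ->.
Qed.

(* Each edge of a maximal matching meets every vertex cover. *)
Lemma matchP n s (adj : rel nat) (X : pred nat) : s 0 0 = n ->
    (forall x y, x < n -> y < n -> s 1 (s 5 x + y) = adj x y) ->
    (forall x, x < n -> s 6 x = 0) -> s 7 0 = 0 ->
    (forall x, x < n -> ~~ adj x x) ->
    (forall x y, x < n -> y < n -> adj x y -> X x || X y) ->
  let s' := den MATCH s in
  [/\ forall x, x < n -> s' 6 x <= 1, s' 7 0 = \sum_(x < n) s' 6 x,
      s' 7 0 <= 2 * \sum_(x < n) X x &
      forall x y, x < n -> y < n -> adj x y -> 0 < s' 6 x + s' 6 y].
Proof.
move=> sn s1 z6 z7 nadj covX s'.
(* A new matching edge raises the left side of the last clause by 2 and the right side by at least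
   2, as X contains one of its ends. *)
pose J (t : state) := [/\ forall x, x < n -> t 6 x <= 1,
  t 7 0 = \sum_(x < n) t 6 x & t 7 0 <= 2 * \sum_(x < n) t 6 x * X x].
pose D (t : state) i j := forall x y, x < n -> y < n ->
  (x < i) || (x == i) && (y < j) -> adj x y -> 0 < t 6 x + t 6 y.
suff [[h1 h2 h3] h4] : J s' /\ D s' n 0.
  split=> // [|x y xn yn]; last by apply: h4 => //; rewrite xn.
  apply: leq_trans h3 _; rewrite leq_mul2l /=; apply: leq_sum => x _.
  by have := h1 x (ltn_ord x); case: (X x); nia.
have es : eval s nE = n by [].
rewrite /s' -[n in D _ n](es).
apply: (@den_for (fun i t => J t /\ D t i 0)) => //.
  move=> t et; split; last by move=> x y _ _; rewrite ltn0 andbF.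
  have t6 x : x < n -> t 6 x = 0 by move=> xn; rewrite et // z6.
  split=> [x xn||]; first by rewrite t6.
    by rewrite et // z7 big1 // => x _; rewrite t6.
  by rewrite et // z7.
move=> i t t''; rewrite es => ni ci fr et IH.
have ent : eval t nE = n by rewrite /= fr.
suff [Jt Dt] : J (den MATCH_ROW t) /\ D (den MATCH_ROW t) i n.
  rewrite /J /D !et //; split=> // x y xn yn.
  rewrite ltn0 andbF orbF ltnS leq_eqVlt => xi; apply: Dt => //.
  by rewrite yn andbT orbC.
rewrite -[n in D _ _ n]ent.
apply: (@den_for (fun j u => J u /\ D u i j)) => //.
  by move=> u eu; rewrite /J /D !eu.
move=> j u u''; rewrite ent => nj cj fru eu [[h1 h2 h3] h4].
have u44 : u 44 0 = i by rewrite fru.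
have skip : u'' 6 = u 6 -> u'' 7 = u 7 -> ~~ (adj i j && (u 6 i + u 6 j == 0)) ->
    J u'' /\ D u'' i j.+1.
  move=> e6 e7 na; rewrite /J /D e6 e7; split=> // x y xn yn xy axy.
  have [|nxy] := boolP ((x < i) || (x == i) && (y < j)); first by move=> ?; apply: h4.
  have [ex ey] : x = i /\ y = j by lia.
  by move: na; rewrite -ex -ey axy /= lt0n.
move: (eu 6 isT) (eu 7 isT); rewrite !den_when !eval_ltE.
have -> : eval u (Get 1 (Add (Get 5 (Var 44)) (Var 45))) = adj i j.
  by rewrite /= u44 cj !fru // !fr // s1.
rewrite /= u44 cj; case aij: (adj i j) => /=; last by move=> *; apply: skip; rewrite ?aij.
case: ltnP => u6i; last by move=> *; apply: skip => //; rewrite negb_and; lia.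
case: ltnP => u6j; last by move=> *; apply: skip => //; rewrite negb_and; lia.
have {u6i u6j} [u6i u6j] : u 6 i = 0 /\ u 6 j = 0 by lia.
rewrite 2!den_seq den_set => e6 e7.
have ij : j != i by apply: contraTneq aij => ->; apply: nadj.
have u6 x : u'' 6 x = upd (upd (u 6) i 1) j 1 x.
  rewrite e6 update_neq // !den_assign update_same update_same /= u44.
  by rewrite update_neq // cj.
have u7 : u'' 7 0 = u 7 0 + 2.
  by rewrite e7 update_eq /= !den_assign !update_neq.
(* One identity for both sums in [J]: G is the entry itself or the entry times [X x]. *)
have S G : G i 0 = 0 -> G j 0 = 0 ->
    \sum_(x < n) G x (u'' 6 x) = \sum_(x < n) G x (u 6 x) + G i 1 + G j 1.
  move=> Gi Gj; under eq_bigr => x _ do rewrite u6.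
  have := sum_upd G (upd (u 6) i 1) 1 nj; have := sum_upd G (u 6) 1 ni.
  have -> : upd (u 6) i 1 j = 0 by rewrite /upd (negPf ij).
  by rewrite u6i Gi Gj !addn0 => <- <-.
split.
  split=> [x xn||].
  - by rewrite u6 /upd; case: eqP => // _; case: eqP => // _; apply: h1.
  - by rewrite u7 h2 (S (fun _ c => c)) // -addnA.
  - rewrite u7 (S (fun x c => c * X x)) // !mul1n.
    have := covX i j ni nj aij.
    move: h3; move: (\sum_(x < n) u 6 x * X x) => Z.
    by case: (X i); case: (X j) => //=; lia.
move=> x y xn yn xy axy; rewrite !u6 /upd.
have [|nxy] := boolP ((x < i) || (x == i) && (y < j)).
  by move=> h; have := h4 x y xn yn h axy; repeat case: ifP => _; lia.
have [ex ey] : x = i /\ y = j by lia.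
by rewrite ex ey !eqxx; repeat case: ifP => _; lia.
Qed.

Lemma powerP s k : s 7 0 = k -> k <= s 0 0 -> den POWER s 8 0 = k.+1 ^ k.+1.
Proof.
move=> sk kn; rewrite /POWER den_seq; set s1 := den _ s.
have e1 : eval s1 n1E = (s 0 0).+1 by rewrite /= /s1 den_frame // addn1.
have -> : k.+1 ^ k.+1 = k.+1 ^ minn (eval s1 n1E) k.+1.
  by rewrite e1 (minn_idPr _).
apply: (@den_for (fun i t => t 8 0 = k.+1 ^ minn i k.+1)) => //.
  by move=> t et; rewrite et // /s1 den_set update_eq min0n.
move=> i t t''; rewrite e1 => ni ci fr et IH.
have tk : t 7 0 = k by rewrite fr // /s1 den_frame.
have tn : eval t n1E = (s 0 0).+1 by rewrite /= fr // /s1 den_frame // addn1.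
rewrite et // den_when eval_ltE /= tk ci addn1.
case: ltnP => ik; last by rewrite IH !(minn_idPr _) // leqW.
rewrite (minn_idPl ik) 2!den_seq den_set update_eq /=; set t1 := den _ t.
have t1n : eval t1 n1E = (s 0 0).+1 by rewrite -tn /= /t1 den_frame.
have t18 : t1 8 0 = k.+1 ^ i.
  by rewrite /t1 den_frame // IH (minn_idPl (ltnW ik)).
have -> : k.+1 ^ i.+1 = minn (eval t1 n1E) k.+1 * k.+1 ^ i.
  by rewrite t1n (minn_idPr _) // expnS.
apply: (@den_for (fun j u => u 9 0 = minn j k.+1 * k.+1 ^ i)) => //.
  by move=> u eu; rewrite eu // /t1 den_set update_eq min0n.
move=> j u u''; rewrite t1n => nj cj fru eu IHu.
have uk : u 7 0 = k by rewrite fru // /t1 den_frame.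
rewrite eu // den_when eval_ltE /= uk cj addn1.
case: ltnP => jk; last by rewrite IHu !(minn_idPr _) // leqW.
rewrite den_set update_eq /= IHu (fru 8) // t18.
by rewrite (minn_idPl jk) (minn_idPl (ltnW jk)) mulSn addnC.
Qed.

Lemma radix1P s k : s 7 0 = k -> forall x, x < s 0 0 ->
  den RADIX1 s 10 x = if s 6 x != 0 then k.+1 else 1.
Proof.
move=> sk; rewrite -[s 0 0]/(eval s nE).
apply: (@den_for (fun i t => forall x, x < i ->
          t 10 x = if s 6 x != 0 then k.+1 else 1)) => //.
move=> i t t'' ni ci fr et IH x xi.
rewrite et // den_if /= ci (fr 6) //.
have [->|xn] := eqVneq x i; last first.
  by case: ifP; rewrite den_assign update_same /= ci (negPf xn) IH //; lia.
case: ifP; rewrite den_assign update_same /= ci eqxx // fr // sk addn1 //.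
Qed.

Lemma radix2P s k : s 7 0 = k -> forall x, x < (s 0 0).+1 ->
  den RADIX2 s 11 x = radix_block k x.
Proof.
move=> sk; have -> : (s 0 0).+1 = eval s n1E by rewrite /= addn1.
apply: (@den_for (fun i t => forall x, x < i -> t 11 x = radix_block k x)) => //.
move=> i t t'' ni ci fr et IH x xi.
have tk : t 7 0 = k by rewrite fr.
rewrite et // den_if eval_ltE /= ci tk addn1 ltnS.
have [->|xn] := eqVneq x i; last first.
  by case: ifP; rewrite den_assign update_same /= ci (negPf xn) IH //; lia.
rewrite /radix_block.
by case: ifP; rewrite den_assign update_same /= ci eqxx // tk addn1.
Qed.

Lemma outP s x : x < s 0 0 ->
  den OUT s 3 x = if s 24 x < s 7 0 then s 24 x else s 7 0 + x.
Proof.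
move=> xn; rewrite /OUT den_seq den_frame //; move: x xn.
rewrite -[s 0 0]/(eval s nE).
apply: (@den_for (fun i t => forall x, x < i ->
          t 3 x = if s 24 x < s 7 0 then s 24 x else s 7 0 + x)) => //.
move=> i t t'' ni ci fr et IH x xi.
rewrite et // den_if eval_ltE /= ci (fr 24) // (fr 7) //.
have [->|xn] := eqVneq x i; last first.
  by case: ifP; rewrite den_assign update_same /= ci (negPf xn) IH //; lia.
by case: ifP; rewrite den_assign update_same /= ci eqxx !fr.
Qed.

Lemma out_flagP s : s 4 0 = 0 ->
  den OUT s 4 0 = (0 < s 0 1) || (s 0 0 == 0).
Proof.
move=> z4; rewrite /OUT den_seq; set s1 := den _ s.
have e0 : s1 0 = s 0 by rewrite /s1 den_frame.
rewrite !den_if /= e0 lt0n; case: eqP => _ /=; last by rewrite den_set update_eq.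
case: eqP => _ /=; first by rewrite den_set update_eq.
by rewrite den_frame // /s1 den_frame.
Qed.

(** * Partitions and assignments *)

Lemma output_C_partition n k C (f : nat -> nat) (l : 'I_n -> nat) :
    (0 < C) || (n == 0) ->
    feasible n k C f ->
    (forall x : 'I_n, l x = if f x < k then f x else k + x) ->
  C_partition C (preim_partition l [set: 'I_n]).
Proof.
move=> C0 fe el; rewrite /C_partition preim_partitionP /=.
apply/forall_inP => B /imsetP[x _ ->].
have nx := ltn_ord x.
have -> : #|[set y in [set: 'I_n] | l x == l y]| = \sum_(y < n) (l x == l y).
  by rewrite -sum1_card big_mkcond; apply: eq_bigr => y _; rewrite !inE; case: eqP.
have [fk|fk] := ltnP (f x) k.
  apply: leq_trans (fe _ fk); apply: leq_sum => y _; rewrite !el fk.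
  by case: (ltnP (f y) k); case: eqP; case: eqP => //; lia.
(* The vertex is alone in its block, and C is positive because n is. *)
have -> : \sum_(y < n) (l x == l y) = 1; last by lia.
rewrite (bigD1 x) //= eqxx big1 // => y yx; apply/eqP; rewrite eqb0.
have nxy : y <> x :> nat by move/val_inj/eqP; rewrite (negPf yx).
by rewrite !el ltnNge fk /=; case: (ltnP (f y) k); lia.
Qed.

Section Graph.
Variables (n : nat) (E : {set {set 'I_n}}) (w : {set 'I_n} -> nat).
Hypothesis simpleE : simple_graph E.
Implicit Types (B U : {set 'I_n}) (P Q : {set {set 'I_n}}).

Definition edge_weight (x y : 'I_n) := if [set x; y] \in E then w [set x; y] else 0.

Lemma edge_neq x y : [set x; y] \in E -> x != y.
Proof. by move=> /(forall_inP simpleE); rewrite cards2; case: (x == y). Qed.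

(* Every edge is counted in both directions. *)
Lemma sum_block B : \sum_(x in B) \sum_(y in B) edge_weight x y =
  2 * \sum_(e in induced_edges E B) w e.
Proof.
rewrite pair_big /= (bigID (fun p => [set p.1; p.2] \in E)) /=.
rewrite [X in _ + X]big1 ?addn0; last first.
  by move=> p /andP[_ /negPf h]; rewrite /edge_weight h.
rewrite (partition_big (fun p : 'I_n * 'I_n => [set p.1; p.2])
           (mem (induced_edges E B))) /=; last first.
  move=> p /andP[/andP[p1 p2] pE]; rewrite inE pE /=.
  by apply/subsetP => z; rewrite !inE => /orP[] /eqP ->.
rewrite big_distrr /=; apply: eq_bigr => e; rewrite inE => /andP[eE eB].
have /cards2P[a [b [ab eab]]] : #|e| == 2 by apply: (forall_inP simpleE).
rewrite (eq_bigr (fun=> w e)); last first.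
  by move=> p /andP[/andP[_ pE] /eqP ep]; rewrite /edge_weight pE ep.
rewrite (eq_bigl (mem [set (a, b); (b, a)])).
  by rewrite sum_nat_const cards2 xpair_eqE negb_and ab.
move=> [x y] /=; rewrite !inE !xpair_eqE.
have aB : a \in B by apply: (subsetP eB); rewrite eab !inE eqxx.
have bB : b \in B by apply: (subsetP eB); rewrite eab !inE eqxx orbT.
apply/idP/idP.
  case/andP=> _ /eqP exy.
  have : b \in [set x; y] by rewrite exy eab !inE eqxx orbT.
  have : a \in [set x; y] by rewrite exy eab !inE eqxx.
  rewrite !inE => /orP[] /eqP <- /orP[] /eqP eb; rewrite ?eb ?eqxx ?orbT //.
    by rewrite eb eqxx in ab.
  by rewrite eb eqxx in ab.
case/orP=> /andP[/eqP -> /eqP ->]; rewrite aB bB /=.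
  by rewrite -eab eE eqxx.
by rewrite setUC -eab eE eqxx.
Qed.

Lemma value_double P : partition P [set: 'I_n] ->
  2 * value E w P = \sum_x \sum_(y in pblock P x) edge_weight x y.
Proof.
move=> pP; have /and3P[/eqP cP tP _] := pP.
have -> : \sum_x \sum_(y in pblock P x) edge_weight x y =
  \sum_(x in [set: 'I_n]) \sum_(y in pblock P x) edge_weight x y.
  by apply: eq_bigl => x; rewrite inE.
rewrite (set_partition_big _ pP) /value big_distrr /=; apply: eq_bigr => B BP.
rewrite -sum_block; apply: eq_bigr => x xB.
by rewrite (def_pblock tP BP xB).
Qed.

Lemma mem_preim_pblock (l : 'I_n -> nat) x y :
  (y \in pblock (preim_partition l [set: 'I_n]) x) = (l x == l y).
Proof.
have eqR : {in [set: 'I_n] & &, equivalence_rel (fun x y => l x == l y)}.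
  by move=> a b c _ _ _; split=> // /eqP ->.
by rewrite (pblock_equivalence_partition eqR).
Qed.

Variables (k C : nat) (W : nat -> nat -> nat) (inU : pred nat).
Hypothesis WE : forall x y : 'I_n, W x y = edge_weight x y.
Lemma output_value (f : nat -> nat) (l : 'I_n -> nat) :
    (forall x : 'I_n, l x = if f x < k then f x else k + x) ->
  2 * value E w (preim_partition l [set: 'I_n]) = aval n k W f.
Proof.
move=> el; rewrite value_double ?preim_partitionP //.
apply: eq_bigr => x _; rewrite big_mkcond; apply: eq_bigr => y _ /=.
rewrite mem_preim_pblock /pair_weight WE.
(* The diagonal is treated apart: a vertex with label k shares its output label with itself, yet
   [pair_weight] is 0 there. Both sides agree because there are no loops. *)
have [->|xy] := eqVneq x y.
  suff -> : edge_weight y y = 0 by rewrite !if_same.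
  by rewrite /edge_weight; case: ifP => // /edge_neq; rewrite eqxx.
have nxy : x <> y :> nat by move/val_inj/eqP; rewrite (negPf xy).
congr (if _ then _ else _); rewrite !el.
by case: (ltnP (f x) k); case: (ltnP (f y) k); lia.
Qed.

Hypothesis coverU : forall x y : 'I_n, [set x; y] \in E -> inU x || inU y.
Hypothesis card_cover : \sum_(x < n) inU x = k.

(* Blocks that miss the cover contain no edge, and at most k blocks meet it.  *)
Lemma C_partition_assignment Q : C_partition C Q -> exists f,
  [/\ forall x, x < n -> f x <= k, feasible n k C f & 2 * value E w Q <= aval n k W f].
Proof.
case/andP=> pQ /forall_inP Q_C; have /and3P[/eqP cQ tQ _] := pQ.
have inQ x : x \in cover Q by rewrite cQ inE.
(* The blocks that meet the cover are listed, and a block receives its position in the list as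
   label. *)
pose L := enum [set pblock Q u | u : 'I_n & inU u].
have Lk : size L <= k.
  rewrite -cardE; apply: leq_trans (leq_imset_card _ _) _.
  rewrite -card_cover -sum1_card big_mkcond leq_eqVlt; apply/orP; left.
  by apply/eqP; apply: eq_bigr => x _; rewrite inE; case: (inU x).
have memL x : (pblock Q x \in L) = (index (pblock Q x) L < size L) by rewrite index_mem.
pose fo (x : 'I_n) := if pblock Q x \in L then index (pblock Q x) L else k.
pose f x := if insub x is Some i then fo i else k.
have fE (x : 'I_n) : f x = fo x by rewrite /f valK.
have fo_lt x : (fo x < k) = (pblock Q x \in L).
  by rewrite /fo; case: ifP => [|_]; [rewrite memL; lia | rewrite ltnn].
have fo_eq x y : fo x < k -> fo x = fo y -> pblock Q x = pblock Q y.
  move=> xk exy; have yk : fo y < k by rewrite -exy.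
  move: exy xk yk; rewrite !fo_lt /fo => + xL yL; rewrite xL yL.
  by move=> e; rewrite -(nth_index set0 xL) e nth_index.
exists f; split.
- move=> x xn; rewrite -[x]/(val (Ordinal xn)) fE /fo.
  by case: ifP => //; rewrite memL; lia.
- move=> b bk; rewrite /load.
  case: (pickP (fun x : 'I_n => fo x == b)) => [x /eqP fx|nx]; last first.
    by rewrite big1 // => x _; rewrite fE nx.
  apply: leq_trans (Q_C (pblock Q x) (pblock_mem (inQ x))).
  rewrite -sum1_card [leqRHS]big_mkcond; apply: leq_sum => y _; rewrite fE.
  case: eqP => //= fy; suff -> : y \in pblock Q x by [].
  by rewrite (fo_eq x y) ?fx // mem_pblock inQ.
- rewrite value_double //; apply: leq_sum => x _.
  rewrite big_mkcond; apply: leq_sum => y _ /=; case: ifP => // yx.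
  rewrite /pair_weight WE !fE /edge_weight; case: ifP => xyE; last by rewrite if_same.
  have exy := same_pblock tQ yx.
  have -> : fo x = fo y by rewrite /fo exy.
  rewrite eqxx fo_lt /=; suff -> : pblock Q y \in L by [].
  rewrite mem_enum; case/orP: (coverU xyE) => u; last by apply: imset_f; rewrite inE.
  by rewrite exy; apply: imset_f; rewrite inE.
Qed.

End Graph.

(** * Correctness and running time *)

Lemma matrix_array_at n (f : 'I_n -> 'I_n -> nat) (i j : 'I_n) :
  matrix_array f (i * n + j) = f i j.
Proof.
have n0 : 0 < n by apply: leq_ltn_trans (ltn_ord i).
rewrite /matrix_array divnMDl // modnMDl divn_small // modn_small // addn0.
by rewrite !valK.
Qed.

Lemma vc_cover n (E : {set {set 'I_n}}) : simple_graph E ->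
  exists2 X, vertex_cover E X & #|X| = vc E.
Proof.
move=> sE; rewrite /vc; case: arg_minnP => [|X cX _]; last by exists X.
apply/forall_inP => e /(forall_inP sE) /eqP e2.
by rewrite setTI -card_gt0 e2.
Qed.

(** The constant 729 is (3^3)^2, reached for v = 1 and k = 2. For v >= 2, k+1 <= 2v+1 <= v^3 bounds
    the square by v^(12v+6), and 6 <= 3v. *)
Lemma square_power_bound v k : k <= 2 * v ->
  (k.+1 ^ k.+1) ^ 2 <= 729 * v ^ (15 * v).
Proof.
case: v => [|[|v]] kv.
- by have -> : k = 0 by lia.
- by rewrite exp1n muln1; have : k <= 2 by []; case: k kv => [|[|[|]]].
set u := v.+2 in kv *.
have u2 : 1 < u by [].
have ku : k.+1 <= u ^ 3 by rewrite !expnS expn0 muln1; nia.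
have h1 : k.+1 ^ k.+1 <= (u ^ 3) ^ (2 * u + 1).
  apply: (@leq_trans (k.+1 ^ (2 * u + 1))); last by rewrite leq_exp2r ?addn1.
  by apply: leq_pexp2l; lia.
apply: leq_trans (leq_mul h1 h1) _; rewrite -expnM -expnD.
apply: leq_trans (leq_pmull _ _) => //; rewrite leq_exp2l //; lia.
Qed.

Definition large_bound e := if e is Get 8 _ then true else false.

(** The shapes n, (k+1)^(k+1) and n+1 of loop bounds, as a boolean test so that whole programs are
    checked by computation. *)
Definition plain_bound e :=
  match e with
  | Get 0 (Const 0) | Get 8 (Const 0) | Add (Get 0 (Const 0)) (Const 1) => true
  | _ => false
  end.

Lemma plain_bound_le s e : plain_bound e ->
  eval s e <= if large_bound e then s 8 0 else (s 0 0).+1.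
Proof.
case: e => [//|a i|e1 e2|//] /=.
  by case: a => [|[|[|[|[|[|[|[|[|a]]]]]]]]] //; case: i => // -[].
case: e1 => // -[|//] [] // -[|//]; case: e2 => // -[|[|//]] //= _.
by rewrite addn1.
Qed.

(** The program is run in two phases because loop bounds of the second read cell 8, which the first
    computes; the composition would not be well formed as a single bounded-loop program. *)
Definition PHASE2 := MAIN ;; OUT.

Lemma PRE_well_formed : well_formed PRE. Proof. by vm_compute. Qed.
Lemma PHASE2_well_formed : well_formed PHASE2. Proof. by vm_compute. Qed.

Section Correctness.
Variables (n : nat) (E : {set {set 'I_n}}) (w : {set 'I_n} -> nat) (C : nat).
Hypothesis simpleE : simple_graph E.

Let s0 := input E w C.
Let e0 := den PRE s0.
Let k := e0 7 0.
Let inU : pred nat := fun x => e0 6 x != 0.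
Let W x y := s0 2 (x * n + y).

Let e0_n : e0 0 0 = n. Proof. by rewrite /e0 den_frame. Qed.
Let e0_C : e0 0 1 = C. Proof. by rewrite /e0 den_frame. Qed.

Let s1 := den ROWS s0.
Let s2 := den MATCH s1.
Let s3 := den POWER s2.
Let s4 := den RADIX1 s3.

Let e0E : e0 = den RADIX2 s4. Proof. by []. Qed.

Let s1_row x : x <= n -> s1 5 x = x * n.
Proof. by move=> xn; rewrite /s1 rowsP. Qed.

Let s2_frame b : b \notin [:: 43; 5; 44; 45; 6; 7] -> s2 b = s0 b.
Proof.
rewrite !inE !negb_or => h; rewrite /s2 den_frame /= ?inE; last by lia.
by rewrite /s1 den_frame //= ?inE; lia.
Qed.

Let e0_match b : b \in [:: 5; 6; 7] -> e0 b = s2 b.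
Proof.
move=> h; have hb : b \notin mods (POWER ;; RADIX1 ;; RADIX2).
  by move: h; rewrite !inE => /or3P[] /eqP ->.
exact: (den_frame (p := POWER ;; RADIX1 ;; RADIX2)).
Qed.

Let adj (x y : nat) := s0 1 (x * n + y) != 0.

Let s0_adj (i j : 'I_n) : s0 1 (i * n + j) = ([set i; j] \in E).
Proof. exact: matrix_array_at. Qed.

Let adjE (i j : 'I_n) : adj i j = ([set i; j] \in E).
Proof. by rewrite /adj s0_adj; case: (_ \in E). Qed.

(** X is arbitrary so that [predT] yields the facts on the matching alone, while a minimum vertex
    cover yields the bound on k. *)
Let match_cover (X : pred nat) :
  (forall i j : 'I_n, [set i; j] \in E -> X i || X j) ->
  [/\ forall x, x < n -> s2 6 x <= 1, s2 7 0 = \sum_(x < n) s2 6 x,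
      s2 7 0 <= 2 * \sum_(x < n) X x &
      forall x y, x < n -> y < n -> adj x y -> 0 < s2 6 x + s2 6 y].
Proof.
move=> hX; apply: matchP.
- by rewrite /s1 den_frame.
- move=> x y xn yn; rewrite s1_row ?(ltnW xn) // /s1 den_frame //.
  rewrite -[x]/(val (Ordinal xn)) -[y]/(val (Ordinal yn)) adjE.
  exact: s0_adj.
- by move=> x xn; rewrite /s1 den_frame.
- by rewrite /s1 den_frame.
- move=> x xn; rewrite -[x]/(val (Ordinal xn)) adjE.
  by apply/negP => /(edge_neq simpleE); rewrite eqxx.
- move=> x y xn yn; rewrite -[x]/(val (Ordinal xn)) -[y]/(val (Ordinal yn)) adjE.
  exact: hX.
Qed.

Let inU_nat x : x < n -> e0 6 x = inU x.
Proof.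
have [//|h _ _ _] := @match_cover predT; move=> xn; rewrite /inU.
by rewrite e0_match //; have := h x xn; case: (s2 6 x) => [|[|]].
Qed.

Let card_inU : \sum_(x < n) inU x = k.
Proof.
have [//|_ h _ _] := @match_cover predT; rewrite /k e0_match // h.
by apply: eq_bigr => x _; rewrite -inU_nat // e0_match.
Qed.

Let k_le_n : k <= n.
Proof.
rewrite -card_inU -[leqRHS]card_ord -sum1_card; apply: leq_sum => x _.
by case: (inU x).
Qed.

Let coverU (i j : 'I_n) : [set i; j] \in E -> inU i || inU j.
Proof.
have [//|_ _ _ h] := @match_cover predT; rewrite -adjE => /(h _ _ (ltn_ord i) (ltn_ord j)).
by rewrite -!(e0_match (b := 6)) // !inU_nat //; case: (inU i); case: (inU j).
Qed.

Let WE (i j : 'I_n) : W i j = edge_weight E w i j.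
Proof. by rewrite /W /s0 /= matrix_array_at. Qed.

Let coverW x y : x < n -> y < n -> ~~ inU x -> ~~ inU y -> W x y = 0.
Proof.
move=> xn yn; rewrite -[x]/(val (Ordinal xn)) -[y]/(val (Ordinal yn)) WE => Ux Uy.
rewrite /edge_weight; case: ifP => // /coverU.
by rewrite (negPf Ux) (negPf Uy).
Qed.

Lemma cover_size : k <= 2 * vc E.
Proof.
have [X cX <-] := vc_cover simpleE.
pose Xp x := if insub x is Some i then i \in X else false.
have XpE (i : 'I_n) : Xp i = (i \in X) by rewrite /Xp valK.
have [|_ _ h _] := @match_cover Xp.
  move=> i j /(forall_inP cX) /set0Pn[z]; rewrite !inE !XpE.
  by case/andP=> zX /orP[] /eqP <-; rewrite zX ?orbT.
rewrite /k e0_match //; apply: leq_trans h _; rewrite leq_mul2l /=.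
rewrite -sum1_card [leqRHS]big_mkcond; apply: leq_sum => i _.
by rewrite XpE; case: (i \in X).
Qed.

Let k_s2 : s2 7 0 = k. Proof. by rewrite /k e0_match. Qed.

Lemma power_PRE : e0 8 0 = k.+1 ^ k.+1.
Proof.
rewrite e0E den_frame // /s4 den_frame // /s3 (powerP k_s2) //.
by rewrite s2_frame.
Qed.

Let radix1_e0 x : x < n -> e0 10 x = radix_cover k inU x.
Proof.
move=> xn; rewrite e0E den_frame // /s4 (@radix1P _ k).
- by rewrite /radix_cover /inU e0_match // /s3 den_frame.
- by rewrite /s3 den_frame.
- by rewrite /s3 den_frame // s2_frame.
Qed.

Let radix2_e0 i : i < n.+1 -> e0 11 i = radix_block k i.
Proof.
move=> ni; rewrite e0E (@radix2P _ k) //.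
  by rewrite /s4 den_frame // /s3 den_frame.
by rewrite /s4 den_frame // /s3 den_frame // s2_frame.
Qed.

Lemma PHASE2_correct : correct_output E w C (den PHASE2 e0).
Proof.
rewrite /PHASE2 den_seq; set sm := den MAIN e0; set sf := den OUT sm.
have e0W x y : x < n -> y < n -> e0 2 (e0 5 x + y) = W x y.
  move=> xn _; rewrite (e0_match (b := 5)) // /s2 den_frame // s1_row ?(ltnW xn) //.
  by rewrite /e0 den_frame.
have [gk gf gopt] : [/\ forall x, x < n -> sm 24 x <= k, feasible n k C (sm 24) &
      forall g, (forall x, x < n -> g x <= k) -> feasible n k C g ->
        aval n k W g <= aval n k W (sm 24)].
  apply: (mainP e0_n e0_C (erefl k) e0W inU_nat k_le_n coverW power_PRE
            radix1_e0 radix2_e0 card_inU) => //.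
  - by move=> x _; rewrite /e0 den_frame.
  - by rewrite /e0 den_frame.
have sm_n : sm 0 0 = n by rewrite /sm den_frame.
have lab (x : 'I_n) : sf 3 x = if sm 24 x < k then sm 24 x else k + x.
  have sm_k : sm 7 0 = k by rewrite /sm den_frame.
  by rewrite /sf outP ?sm_n // sm_k.
have flag : sf 4 0 = (0 < C) || (n == 0).
  rewrite /sf out_flagP ?sm_n; last by rewrite /sm den_frame // /e0 den_frame.
  by rewrite /sm den_frame // e0_C.
rewrite /correct_output; case: ifP => [/existsP[P /andP[pP /forall_inP P_C]]|].
  have C0 : (0 < C) || (n == 0).
    have [n0|n0] := posnP n; first by rewrite orbT.
    have /and3P[/eqP cP tP nP] := pP.
    have xP : Ordinal n0 \in cover P by rewrite cP inE.
    have le := P_C _ (pblock_mem xP).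
    suff gt : 0 < #|pblock P (Ordinal n0)| by rewrite (leq_trans gt le).
    by apply/card_gt0P; exists (Ordinal n0); rewrite mem_pblock.
  rewrite flag C0; split=> //; split; first exact: (output_C_partition C0 gf lab).
  move=> Q cQ; rewrite -(leq_pmul2l (isT : 0 < 2)).
  rewrite (output_value simpleE WE lab).
  have [f [fk ff fv]] := C_partition_assignment simpleE WE coverU card_inU cQ.
  by apply: leq_trans fv _; apply: gopt.
move=> nP; rewrite flag; case C0: (_ || _) => //.
(* A nonzero flag would make the output itself a C-partition. *)
suff : [exists P : {set {set 'I_n}}, C_partition C P] by rewrite nP.
by apply/existsP; exists (output_partition n sf); apply: (output_C_partition C0 gf lab).
Qed.

End Correctness.

Theorem theorem1p3 :
  exists (p : cmd) (a b c : nat),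
    forall (n : nat) (E : {set {set 'I_n}}) (w : {set 'I_n} -> nat) (C : nat),
      simple_graph E ->
      exists (t : nat) (s : state),
        [/\ exec p (input E w C) t s,
            t <= c * vc E ^ (a * vc E) * n.+1 ^ b
          & correct_output E w C s].
Proof.
(* The exponent of n+1 counts the loops with bound n or n+1; all loops of [PRE] are of this kind. *)
pose b1 := count_loops (predC pred0) PRE.
pose b2 := count_loops (predC large_bound) PHASE2.
exists (Seq (compile PRE) (compile PHASE2)), 15, (b1 + b2).
exists ((size_prog PRE + size_prog PHASE2) * 729) => n E w C simpleE.
set s0 := input E w C.
have [t1 ex1 l1] := exec_compile s0 PRE_well_formed.
have [t2 ex2 l2] := exec_compile (den PRE s0) PHASE2_well_formed.
exists (t1 + t2), (den PHASE2 (den PRE s0)).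
split; [exact: exec_Seq ex1 ex2 | | exact: PHASE2_correct].
have kv := cover_size w C simpleE; rewrite -/s0 in kv.
have e8 := power_PRE w C simpleE; rewrite -/s0 in e8.
set k := den PRE s0 7 0 in kv e8.
have M0 : 0 < k.+1 ^ k.+1 by rewrite expn_gt0.
have {l1} h1 : t1 <= size_prog PRE * n.+1 ^ b1.
  apply: leq_trans l1 _.
  have := @time_bound_le pred0 PRE s0 n.+1 1 isT isT.
  rewrite exp1n muln1; apply.
  have : all (fun e => plain_bound e && ~~ large_bound e) (bounds PRE) by vm_compute.
  apply: sub_all => e /andP[pe le]; apply: leq_trans (plain_bound_le s0 pe) _.
  by rewrite (negPf le).
have {l2} h2 : t2 <= size_prog PHASE2 * (n.+1 ^ b2 * (k.+1 ^ k.+1) ^ 2).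
  have plain : all plain_bound (bounds PHASE2) by vm_compute.
  apply: leq_trans l2 _.
  have := @time_bound_le large_bound PHASE2 (den PRE s0) n.+1 _ isT M0.
  (* One loop over the labellings of the cover, and one over the maps H. *)
  have -> : count_loops large_bound PHASE2 = 2 by vm_compute.
  apply; apply: sub_all plain => e pe.
  apply: leq_trans (plain_bound_le _ pe) _; rewrite e8.
  by rewrite [den PRE s0 0]den_frame.
have := square_power_bound kv; set V := vc E ^ _ => hV.
have M20 : 0 < (k.+1 ^ k.+1) ^ 2 by rewrite expn_gt0 M0.
have N1 : 0 < n.+1 ^ b1 by rewrite expn_gt0.
have N2 : 0 < n.+1 ^ b2 by rewrite expn_gt0.
rewrite -mulnA -mulnA mulnDl; apply: leq_add.
  apply: leq_trans h1 _; rewrite leq_mul2l; apply/orP; right.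
  rewrite mulnA expnD; apply: leq_trans (leq_pmull _ (leq_trans M20 hV)).
  by rewrite leq_pmulr.
apply: leq_trans h2 _; rewrite leq_mul2l; apply/orP; right.
rewrite mulnA mulnC; apply: leq_mul => //.
by rewrite expnD leq_pmull.
Qed.
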